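(* Let $R$ be a local Noetherian $F$-pure unique factorization domain of prime characteristic $p>0$. Then the perfection $R_{\mathrm{perf}}$ is a GCD domain which is not coherent in either of the following two cases: (1) $R$ is not weakly $F$-regular; (2) $R$ is excellent and not Cohen--Macaulay.
   Context: For a ring $R$ of prime characteristic $p>0$, the perfection (perfect closure) of $R$ is $R_{\mathrm{perf}}=\varinjlim\left(R\xrightarrow{F}R\xrightarrow{F}\cdots\right)$, where $F:R\to R$ is the Frobenius map $r\mapsto r^p$. A commutative ring is coherent if all of its finitely generated ideals are finitely presented. A domain $A$ (not necessarily Noetherian) is a GCD domain if for all $r,s\in A$ the ideal $rA\cap sA$ is principal (equivalently, the ideal $(r:_A s)=\{x\in A\mid xs\in rA\}$ is principal for all $r,s \in A$ with $s\neq 0$). Let $R$ be a Noetherian ring of prime characteristic $p>0$. Write $F_*R$ for $R$ viewed as an $R$-module via Frobenius. $R$ is $F$-pure if the Frobenius map $F:R\to F_*R$ is a pure homomorphism of $R$-modules, i.e. $M\to M\otimes_R F_*R$ is injective for every $R$-module $M$. For an ideal $I\subseteq R$, let $I^{[p^e]}$ denote the ideal generated by all $p^e$-th powers of elements of $I$. The tight closure of $I$ is $$I^*=\Big\{r\in R\;\Big|\;\text{there exists } c\in R\setminus\bigcup_{\mathfrak p\in\min(R)}\mathfrak p \text{ such that } c\,r^{p^e}\in I^{[p^e]}\text{ for all } e\gg 0\Big\},$$ where $\min(R)$ is the set of minimal primes of $R$. $R$ is weakly $F$-regular if $I=I^*$ for all ideals $I\subseteq R$. *)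

(* Defs.v *)
From HB Require Import structures.
From mathcomp Require Import all_boot all_algebra.
From mathcomp Require Import boolp classical_sets.
From mathcomp Require Import ring.

Set Implicit Arguments.
Unset Strict Implicit.
Unset Printing Implicit Defensive.

Import GRing.Theory.

Local Open Scope classical_set_scope.
Local Open Scope ring_scope.
Local Open Scope quotient_scope.

(* Rings are commutative with unit.  Zero rings occur below (as tensor
   products, or as algebras of finite type), whence comPzRingType. *)

Section Ideals.
Variable R : comPzRingType.
Implicit Types (A I J P M : set R) (x y : R).

Definition is_ideal I : Prop :=
  [/\ I 0, forall x y, I x -> I y -> I (x + y)
         & forall a x, I x -> I (a * x)].

Definition ideal_gen A : set R := smallest is_ideal A.

Definition fin_gen I : Prop := exists s : seq R, I = ideal_gen [set` s].

Definition principal I : Prop := exists a : R, I = ideal_gen [set a].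

Definition is_prime P : Prop :=
  [/\ is_ideal P, ~ P 1 & forall x y, P (x * y) -> P x \/ P y].

Definition is_maximal M : Prop :=
  [/\ is_ideal M, ~ M 1
    & forall I, is_ideal I -> M `<=` I -> I = M \/ I = [set: R]].

Definition minimal_prime P : Prop :=
  is_prime P /\ forall Q : set R, is_prime Q -> Q `<=` P -> Q = P.

Definition noetherian : Prop := forall I, is_ideal I -> fin_gen I.

Definition local_with M : Prop := forall N : set R, is_maximal N <-> N = M.

Definition local_ring : Prop := exists M, local_with M.

Definition is_domain : Prop :=
  (1 : R) <> 0 /\ forall x y, x * y = 0 -> x = 0 \/ y = 0.

Fixpoint ideal_pow I (n : nat) : set R :=
  if n is n'.+1 then
    ideal_gen [set z | exists x y, [/\ I x, ideal_pow I n' y & z = x * y]]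
  else [set: R].

Lemma ideal_gen_ideal A : is_ideal (ideal_gen A).
Proof.
split=> [M [[M0 _ _] _] //|x y hx hy M hM|a x hx M hM].
  by have [[_ MD _] _] := hM; apply: MD; [apply: hx|apply: hy].
by have [[_ _ MM] _] := hM; apply: MM; apply: hx.
Qed.

Lemma ideal_pow_ideal I n : is_ideal (ideal_pow I n).
Proof. by case: n => [|n]; [split|apply: ideal_gen_ideal]. Qed.

Lemma idealN I x : is_ideal I -> I x -> I (- x).
Proof. by case=> _ _ IM Ix; rewrite -mulN1r; apply: IM. Qed.

(* I is finitely presented: there is an exact sequence
   R^m --K--> R^n --a--> I --> 0  (vectors are rows). *)
Definition fin_presented I : Prop :=
  exists (n m : nat) (a : 'cV[R]_n) (K : 'M[R]_(m, n)),
    (forall x, I x <-> exists c : 'rV[R]_n, c *m a = x%:M) /\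
    (forall c : 'rV[R]_n, c *m a = 0 <-> exists u : 'rV[R]_m, c = u *m K).

Definition coherent : Prop :=
  forall I, is_ideal I -> fin_gen I -> fin_presented I.

Definition gcd_domain : Prop :=
  is_domain /\
  forall r s : R, principal (ideal_gen [set r] `&` ideal_gen [set s]).

Definition frob_power I (q : nat) : set R :=
  ideal_gen [set x ^+ q | x in I].

Definition tight_closure (p : nat) I : set R :=
  [set r | exists c : R, (forall P, minimal_prime P -> ~ P c) /\
     exists e0 : nat, forall e : nat, (e0 <= e)%N ->
       frob_power I (p ^ e) (c * r ^+ (p ^ e))].

Definition weakly_F_regular (p : nat) : Prop :=
  forall I, is_ideal I -> I = tight_closure p I.

Definition prime_chain (n : nat) (c : nat -> set R) : Prop :=
  (forall i, (i <= n)%N -> is_prime (c i)) /\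
  (forall i, (i < n)%N -> c i `<` c i.+1).

Definition krull_dim (d : nat) : Prop :=
  (exists c, prime_chain d c) /\
  (forall n c, prime_chain n c -> (n <= d)%N).

Definition chain_between P Q (n : nat) (c : nat -> set R) : Prop :=
  [/\ prime_chain n c, c 0%N = P & c n = Q].

Definition maximal_chain (n : nat) (c : nat -> set R) : Prop :=
  forall i, (i < n)%N ->
    forall T : set R, is_prime T -> ~ (c i `<` T /\ T `<` c i.+1).

Definition catenary : Prop :=
  forall P Q, is_prime P -> is_prime Q -> P `<=` Q ->
    exists d : nat, forall n c, chain_between P Q n c ->
      (n <= d)%N /\ (maximal_chain n c -> n = d).

Definition regular_seq (s : seq R) : Prop :=
  ideal_gen [set` s] <> [set: R] /\
  forall i, (i < size s)%N -> forall x : R,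
    ideal_gen [set` take i s] (s`_i * x) -> ideal_gen [set` take i s] x.

Definition depth_in I (d : nat) : Prop :=
  (exists s, [/\ regular_seq s, [set` s] `<=` I & size s = d]) /\
  (forall s, regular_seq s -> [set` s] `<=` I -> (size s <= d)%N).

Definition cohen_macaulay_local : Prop :=
  exists2 M, local_with M & exists2 d, krull_dim d & depth_in M d.

Definition regular_local : Prop :=
  noetherian /\
  exists2 M, local_with M &
    exists2 s : seq R, M = ideal_gen [set` s] & krull_dim (size s).

Definition is_subring (S : set R) : Prop :=
  [/\ S 1, forall x y, S x -> S y -> S (x - y)
         & forall x y, S x -> S y -> S (x * y)].

Definition Spec : Type := {P : set R | is_prime P}.

End Ideals.

Definition finite_type (A B : comPzRingType) (f : {rmorphism A -> B}) : Prop :=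
  exists s : seq B,
    smallest (@is_subring B) (range f `|` [set` s]) = [set: B].

Section UniqueFactorization.
Variable R : idomainType.

Definition irreducible_elt (x : R) : Prop :=
  [/\ x != 0, x \isn't a GRing.unit
    & forall a b : R, x = a * b ->
        a \is a GRing.unit \/ b \is a GRing.unit].

Definition ufd : Prop :=
  (forall x : R, x != 0 -> x \isn't a GRing.unit ->
     exists2 s : seq R, (forall a, a \in s -> irreducible_elt a)
                      & x = \prod_(a <- s) a) /\
  (forall s t : seq R,
     (forall a, a \in s -> irreducible_elt a) ->
     (forall a, a \in t -> irreducible_elt a) ->
     \prod_(a <- s) a = \prod_(a <- t) a ->
     exists t' : seq R, [/\ perm_eq t t', size s = size t'
       & forall i, (i < size s)%N ->
           exists2 u, u \is a GRing.unit & s`_i = u * t'`_i]).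

End UniqueFactorization.

(* Operations satisfying the ring axioms up to an equivalence; the rings
   constructed below are the quotients of such structures. *)
Record setoid_ring := SetoidRing {
  sr_car :> Type;
  sr_eq : sr_car -> sr_car -> Prop;
  sr_zero : sr_car;
  sr_one : sr_car;
  sr_opp : sr_car -> sr_car;
  sr_add : sr_car -> sr_car -> sr_car;
  sr_mul : sr_car -> sr_car -> sr_car;
  sr_refl : forall x, sr_eq x x;
  sr_sym : forall x y, sr_eq x y -> sr_eq y x;
  sr_trans : forall x y z, sr_eq x y -> sr_eq y z -> sr_eq x z;
  sr_oppW : forall x y, sr_eq x y -> sr_eq (sr_opp x) (sr_opp y);
  sr_addW : forall x y z, sr_eq x y -> sr_eq (sr_add x z) (sr_add y z);
  sr_mulW : forall x y z, sr_eq x y -> sr_eq (sr_mul x z) (sr_mul y z);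
  sr_addA : forall x y z,
    sr_eq (sr_add x (sr_add y z)) (sr_add (sr_add x y) z);
  sr_addC : forall x y, sr_eq (sr_add x y) (sr_add y x);
  sr_add0 : forall x, sr_eq (sr_add sr_zero x) x;
  sr_addN : forall x, sr_eq (sr_add (sr_opp x) x) sr_zero;
  sr_mulA : forall x y z,
    sr_eq (sr_mul x (sr_mul y z)) (sr_mul (sr_mul x y) z);
  sr_mulC : forall x y, sr_eq (sr_mul x y) (sr_mul y x);
  sr_mul1 : forall x, sr_eq (sr_mul sr_one x) x;
  sr_mulD : forall x y z,
    sr_eq (sr_mul (sr_add x y) z) (sr_add (sr_mul x z) (sr_mul y z))
}.

Section ClassicalQuotient.
Variables (T : Type) (e : T -> T -> Prop).
Hypotheses (er : forall x, e x x) (es : forall x y, e x y -> e y x).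
Hypothesis et : forall x y z, e x y -> e y z -> e x z.

Definition brel : rel {classic T} := fun x y => `[< e x y >].

Lemma brel_refl : reflexive brel.
Proof. by move=> x; apply/asboolP. Qed.

Lemma brel_sym : symmetric brel.
Proof. by move=> x y; apply/asboolP/asboolP; apply: es. Qed.

Lemma brel_trans : transitive brel.
Proof. by move=> y x z /asboolP xy /asboolP yz; apply/asboolP/et/yz. Qed.

Definition brel_equiv : equiv_rel {classic T} :=
  EquivRel brel brel_refl brel_sym brel_trans.

Definition cquot : Type := {eq_quot brel_equiv}.
HB.instance Definition _ := Choice.on cquot.

Definition cclass (x : T) : cquot := \pi_({eq_quot brel_equiv}) x.
Definition crepr (X : cquot) : T := repr (X : {eq_quot brel_equiv}).

Lemma creprK X : cclass (crepr X) = X.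
Proof. exact: reprK. Qed.

Lemma cclassP x y : cclass x = cclass y <-> e x y.
Proof.
split=> [/(@eqmodP _ brel_equiv)|h]; first by move/asboolP.
by apply/(@eqmodP _ brel_equiv)/asboolP.
Qed.

Lemma crepr_class x : e (crepr (cclass x)) x.
Proof. by apply/cclassP; rewrite creprK. Qed.

End ClassicalQuotient.

Section SetoidRingQuotient.
Variable S : setoid_ring.
Local Notation "x ~~ y" := (sr_eq x y) (at level 70).

Definition sr_quot : Type := cquot (@sr_refl S) (@sr_sym S) (@sr_trans S).
HB.instance Definition _ := Choice.on sr_quot.

Definition sr_class (x : S) : sr_quot := cclass _ _ _ x.
Definition sr_repr (X : sr_quot) : S := crepr X.

Lemma sr_classP x y : sr_class x = sr_class y <-> x ~~ y.
Proof. exact: cclassP. Qed.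

Lemma sr_repr_class x : sr_repr (sr_class x) ~~ x.
Proof. exact: crepr_class. Qed.

Lemma sr_quotP (X : sr_quot) : exists x, X = sr_class x.
Proof. by exists (sr_repr X); rewrite /sr_class creprK. Qed.

Definition srq_opp X := sr_class (sr_opp (sr_repr X)).
Definition srq_add X Y := sr_class (sr_add (sr_repr X) (sr_repr Y)).
Definition srq_mul X Y := sr_class (sr_mul (sr_repr X) (sr_repr Y)).

Lemma sr_oppE x : srq_opp (sr_class x) = sr_class (sr_opp x).
Proof. by apply/sr_classP/sr_oppW/sr_repr_class. Qed.

Lemma sr_addE x y : srq_add (sr_class x) (sr_class y) = sr_class (sr_add x y).
Proof.
apply/sr_classP; apply: sr_trans (sr_addW _ (sr_repr_class x)) _.
apply: sr_trans (sr_addC _ _) _.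
exact: sr_trans (sr_addW _ (sr_repr_class y)) (sr_addC _ _).
Qed.

Lemma sr_mulE x y : srq_mul (sr_class x) (sr_class y) = sr_class (sr_mul x y).
Proof.
apply/sr_classP; apply: sr_trans (sr_mulW _ (sr_repr_class x)) _.
apply: sr_trans (sr_mulC _ _) _.
exact: sr_trans (sr_mulW _ (sr_repr_class y)) (sr_mulC _ _).
Qed.

Fact srq_addA : associative srq_add.
Proof.
move=> X Y Z; have [[x ->] [y ->]] := conj (sr_quotP X) (sr_quotP Y).
have [z ->] := sr_quotP Z.
by rewrite !sr_addE; apply/sr_classP/sr_addA.
Qed.

Fact srq_addC : commutative srq_add.
Proof.
move=> X Y; have [[x ->] [y ->]] := conj (sr_quotP X) (sr_quotP Y).
by rewrite !sr_addE; apply/sr_classP/sr_addC.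
Qed.

Fact srq_add0 : left_id (sr_class (sr_zero S)) srq_add.
Proof.
by move=> X; have [x ->] := sr_quotP X; rewrite sr_addE; apply/sr_classP/sr_add0.
Qed.

Fact srq_addN : left_inverse (sr_class (sr_zero S)) srq_opp srq_add.
Proof.
move=> X; have [x ->] := sr_quotP X.
by rewrite sr_oppE sr_addE; apply/sr_classP/sr_addN.
Qed.

HB.instance Definition _ :=
  GRing.isZmodule.Build sr_quot srq_addA srq_addC srq_add0 srq_addN.

Fact srq_mulA : associative srq_mul.
Proof.
move=> X Y Z; have [[x ->] [y ->]] := conj (sr_quotP X) (sr_quotP Y).
have [z ->] := sr_quotP Z.
by rewrite !sr_mulE; apply/sr_classP/sr_mulA.
Qed.

Fact srq_mulC : commutative srq_mul.
Proof.
move=> X Y; have [[x ->] [y ->]] := conj (sr_quotP X) (sr_quotP Y).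
by rewrite !sr_mulE; apply/sr_classP/sr_mulC.
Qed.

Fact srq_mul1 : left_id (sr_class (sr_one S)) srq_mul.
Proof.
by move=> X; have [x ->] := sr_quotP X; rewrite sr_mulE; apply/sr_classP/sr_mul1.
Qed.

Fact srq_mulD : left_distributive srq_mul +%R.
Proof.
move=> X Y Z; have [[x ->] [y ->]] := conj (sr_quotP X) (sr_quotP Y).
have [z ->] := sr_quotP Z.
have addE x' y' : sr_class x' + sr_class y' = sr_class (sr_add x' y').
  exact: sr_addE.
rewrite addE !sr_mulE addE.
exact/sr_classP/sr_mulD.
Qed.

HB.instance Definition _ :=
  GRing.Zmodule_isComPzRing.Build sr_quot srq_mulA srq_mulC srq_mul1 srq_mulD.

Lemma sr_class_zmod (A : zmodType) (f : A -> S) :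
  (forall x y, f (x - y) ~~ sr_add (f x) (sr_opp (f y))) ->
  zmod_morphism (sr_class \o f).
Proof.
move=> fB x y; transitivity (srq_add (sr_class (f x)) (srq_opp (sr_class (f y)))).
  by rewrite sr_oppE sr_addE; apply/sr_classP.
by [].
Qed.

Lemma sr_class_monoid (A : pzRingType) (f : A -> S) :
  f 1 ~~ sr_one S -> (forall x y, f (x * y) ~~ sr_mul (f x) (f y)) ->
  monoid_morphism (sr_class \o f).
Proof.
move=> f1 fM; split=> [|x y]; first exact/sr_classP.
transitivity (srq_mul (sr_class (f x)) (sr_class (f y))); last by [].
by rewrite sr_mulE; apply/sr_classP.
Qed.

End SetoidRingQuotient.

(* The colimit of R -phi-> R -phi-> ...; the pair (e, r) stands for the image
   of the element r of the e-th copy of R. *)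
Section IteratedColimit.
Variables (R : comPzRingType) (phi : {rmorphism R -> R}).
Implicit Types x y z : nat * R.

Definition col_eq x y : Prop :=
  exists k : nat, iter (y.1 + k) phi x.2 = iter (x.1 + k) phi y.2.
Definition col_opp x : nat * R := (x.1, - x.2).
Definition col_add x y : nat * R :=
  ((x.1 + y.1)%N, iter y.1 phi x.2 + iter x.1 phi y.2).
Definition col_mul x y : nat * R :=
  ((x.1 + y.1)%N, iter y.1 phi x.2 * iter x.1 phi y.2).

Let itD n : {morph iter n phi : x y / x + y}.
Proof. by elim: n => // n IH x y; rewrite !iterS IH rmorphD. Qed.
Let itM n : {morph iter n phi : x y / x * y}.
Proof. by elim: n => // n IH x y; rewrite !iterS IH rmorphM. Qed.
Let itN n : {morph iter n phi : x / - x}.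
Proof. by elim: n => // n IH x; rewrite !iterS IH rmorphN. Qed.
Let it0 n : iter n phi 0 = 0.
Proof. by elim: n => //= n ->; rewrite rmorph0. Qed.
Let it1 n : iter n phi 1 = 1.
Proof. by elim: n => //= n ->; rewrite rmorph1. Qed.

Fact col_refl x : col_eq x x. Proof. by exists 0%N. Qed.

Fact col_sym x y : col_eq x y -> col_eq y x.
Proof. by case=> k h; exists k. Qed.

Fact col_trans x y z : col_eq x y -> col_eq y z -> col_eq x z.
Proof.
case=> k hk [l hl]; exists (y.1 + k + l)%N.
have -> : (z.1 + (y.1 + k + l) = (z.1 + l) + (y.1 + k))%N by ring.
have -> : (x.1 + (y.1 + k + l) = (x.1 + k) + (y.1 + l))%N by ring.
rewrite iterD hk -iterD addnC iterD hl -iterD.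
by congr (iter _ _ _); ring.
Qed.

Fact col_oppW x y : col_eq x y -> col_eq (col_opp x) (col_opp y).
Proof. by case=> k h; exists k; rewrite /= !itN h. Qed.

Fact col_step x y z (k : nat) : iter (y.1 + k) phi x.2 = iter (x.1 + k) phi y.2 ->
  iter (y.1 + z.1 + k) phi (iter z.1 phi x.2) =
    iter (x.1 + z.1 + k) phi (iter z.1 phi y.2) /\
  iter (y.1 + z.1 + k) phi (iter x.1 phi z.2) =
    iter (x.1 + z.1 + k) phi (iter y.1 phi z.2).
Proof.
move=> h; split; rewrite -!iterD; last by congr (iter _ _ _); ring.
have -> : (y.1 + z.1 + k + z.1 = z.1 + z.1 + (y.1 + k))%N by ring.
have -> : (x.1 + z.1 + k + z.1 = z.1 + z.1 + (x.1 + k))%N by ring.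
by rewrite iterD h -iterD.
Qed.

Fact col_addW x y z : col_eq x y -> col_eq (col_add x z) (col_add y z).
Proof.
by case=> k /(@col_step _ _ z) [h1 h2]; exists k; rewrite /= !itD h1 h2.
Qed.

Fact col_mulW x y z : col_eq x y -> col_eq (col_mul x z) (col_mul y z).
Proof.
by case=> k /(@col_step _ _ z) [h1 h2]; exists k; rewrite /= !itM h1 h2.
Qed.

Fact col_addA x y z :
  col_eq (col_add x (col_add y z)) (col_add (col_add x y) z).
Proof.
exists 0%N; rewrite /= !addn0 !itD -!iterD addrA.
by congr (_ + _ + _); congr (iter _ _ _); ring.
Qed.

Fact col_addC x y : col_eq (col_add x y) (col_add y x).
Proof. by exists 0%N; rewrite /= addrC; congr (iter _ _ _); ring. Qed.

Fact col_add0 x : col_eq (col_add (0%N, 0) x) x.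
Proof. by exists 0%N; rewrite /= it0 add0r. Qed.

Fact col_addN x : col_eq (col_add (col_opp x) x) (0%N, 0).
Proof. by exists 0%N; rewrite /= itN addNr !it0. Qed.

Fact col_mulA x y z :
  col_eq (col_mul x (col_mul y z)) (col_mul (col_mul x y) z).
Proof.
exists 0%N; rewrite /= !addn0 !itM -!iterD mulrA.
by congr (_ * _ * _); congr (iter _ _ _); ring.
Qed.

Fact col_mulC x y : col_eq (col_mul x y) (col_mul y x).
Proof. by exists 0%N; rewrite /= mulrC; congr (iter _ _ _); ring. Qed.

Fact col_mul1 x : col_eq (col_mul (0%N, 1) x) x.
Proof. by exists 0%N; rewrite /= it1 mul1r. Qed.

Fact col_mulD x y z : col_eq (col_mul (col_add x y) z)
                            (col_add (col_mul x z) (col_mul y z)).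
Proof.
exists 0%N; rewrite /= !addn0 !(itD, itM) -!iterD mulrDl.
by congr (_ * _ + _ * _); congr (iter _ _ _); ring.
Qed.

Definition iter_colim_setoid : setoid_ring :=
  SetoidRing col_refl col_sym col_trans col_oppW col_addW col_mulW
    col_addA col_addC col_add0 col_addN col_mulA col_mulC col_mul1 col_mulD.

Definition iter_colim : comPzRingType := sr_quot iter_colim_setoid.

End IteratedColimit.

Section Localization.
Variables (R : comPzRingType) (P : Spec R).

Fact loc_den1 : ~ sval P 1. Proof. by case: P => p []. Qed.
Fact loc_denM x y : ~ sval P x -> ~ sval P y -> ~ sval P (x * y).
Proof. by case: P => p [_ _ h] /= Px Py /h []. Qed.

Definition fraction_pair : Type := R * {s : R | ~ sval P s}.
Implicit Types x y z : fraction_pair.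
Definition num x : R := x.1.
Definition den x : R := sval x.2.

Definition loc_eq x y : Prop :=
  exists u : R, ~ sval P u /\ u * (num x * den y) = u * (num y * den x).

Definition mk_frac a s (Ss : ~ sval P s) : fraction_pair := (a, exist _ s Ss).

Definition loc_opp x : fraction_pair := (- num x, x.2).
Definition loc_add x y : fraction_pair :=
  mk_frac (num x * den y + num y * den x) (loc_denM (svalP x.2) (svalP y.2)).
Definition loc_mul x y : fraction_pair :=
  mk_frac (num x * num y) (loc_denM (svalP x.2) (svalP y.2)).

Let numD x y : num (loc_add x y) = num x * den y + num y * den x.
Proof. by []. Qed.
Let denD x y : den (loc_add x y) = den x * den y. Proof. by []. Qed.
Let numM x y : num (loc_mul x y) = num x * num y. Proof. by []. Qed.
Let denM x y : den (loc_mul x y) = den x * den y. Proof. by []. Qed.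
Let numN x : num (loc_opp x) = - num x. Proof. by []. Qed.
Let denN x : den (loc_opp x) = den x. Proof. by []. Qed.
Let num_mk a s (Ps : ~ sval P s) : num (mk_frac a Ps) = a. Proof. by []. Qed.
Let den_mk a s (Ps : ~ sval P s) : den (mk_frac a Ps) = s. Proof. by []. Qed.
Let locE := (numD, denD, numM, denM, numN, denN, num_mk, den_mk).

Let by_eq x y : num x * den y = num y * den x -> loc_eq x y.
Proof. by move=> h; exists 1; split; [exact: loc_den1|rewrite h]. Qed.

Fact loc_refl x : loc_eq x x. Proof. exact: by_eq. Qed.

Fact loc_sym x y : loc_eq x y -> loc_eq y x.
Proof. by case=> u [Su h]; exists u. Qed.

Fact loc_trans x y z : loc_eq x y -> loc_eq y z -> loc_eq x z.
Proof.
case=> u [Su hu] [v [Sv hv]]; exists (u * v * den y); split.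
  by apply: loc_denM (svalP y.2); apply: loc_denM.
have -> : u * v * den y * (num x * den z)
   = v * den z * (u * (num x * den y)) by ring.
rewrite hu.
have -> : v * den z * (u * (num y * den x))
   = u * den x * (v * (num y * den z)) by ring.
by rewrite hv; ring.
Qed.

Fact loc_oppW x y : loc_eq x y -> loc_eq (loc_opp x) (loc_opp y).
Proof.
case=> u [Su h]; exists u; split=> //.
by rewrite /num /den /= !mulNr !mulrN; congr (- _).
Qed.

Fact loc_addW x y z : loc_eq x y -> loc_eq (loc_add x z) (loc_add y z).
Proof.
case=> u [Su h]; exists u; split=> //; rewrite !locE.
have -> : u * ((num x * den z + num z * den x) * (den y * den z))
  = den z * den z * (u * (num x * den y))
    + u * num z * den x * den y * den z by ring.
by rewrite h; ring.
Qed.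

Fact loc_mulW x y z : loc_eq x y -> loc_eq (loc_mul x z) (loc_mul y z).
Proof.
case=> u [Su h]; exists u; split=> //; rewrite !locE.
have -> : u * (num x * num z * (den y * den z))
  = num z * den z * (u * (num x * den y)) by ring.
by rewrite h; ring.
Qed.

Fact loc_addA x y z :
  loc_eq (loc_add x (loc_add y z)) (loc_add (loc_add x y) z).
Proof. by apply: by_eq; rewrite !locE; ring. Qed.

Fact loc_addC x y : loc_eq (loc_add x y) (loc_add y x).
Proof. by apply: by_eq; rewrite !locE; ring. Qed.

Fact loc_add0 x : loc_eq (loc_add (mk_frac 0 loc_den1) x) x.
Proof. by apply: by_eq; rewrite !locE; ring. Qed.

Fact loc_addN x : loc_eq (loc_add (loc_opp x) x) (mk_frac 0 loc_den1).
Proof. by apply: by_eq; rewrite !locE; ring. Qed.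

Fact loc_mulA x y z :
  loc_eq (loc_mul x (loc_mul y z)) (loc_mul (loc_mul x y) z).
Proof. by apply: by_eq; rewrite !locE; ring. Qed.

Fact loc_mulC x y : loc_eq (loc_mul x y) (loc_mul y x).
Proof. by apply: by_eq; rewrite !locE; ring. Qed.

Fact loc_mul1 x : loc_eq (loc_mul (mk_frac 1 loc_den1) x) x.
Proof. by apply: by_eq; rewrite !locE; ring. Qed.

Fact loc_mulD x y z : loc_eq (loc_mul (loc_add x y) z)
                            (loc_add (loc_mul x z) (loc_mul y z)).
Proof. by apply: by_eq; rewrite !locE; ring. Qed.

Definition localization_setoid : setoid_ring :=
  SetoidRing loc_refl loc_sym loc_trans loc_oppW loc_addW loc_mulW
    loc_addA loc_addC loc_add0 loc_addN loc_mulA loc_mulC loc_mul1 loc_mulD.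

Definition localization : comPzRingType := sr_quot localization_setoid.

End Localization.

(* lim R / I^n : x stands for the compatible family (x n mod I^n)_n. *)
Section Completion.
Variables (R : comPzRingType) (I : set R).

Definition compatible (x : nat -> R) : Prop :=
  forall n, ideal_pow I n (x n.+1 - x n).
Definition compatible_family : Type := {x : nat -> R | compatible x}.
Implicit Types x y z : compatible_family.
Definition fam x : nat -> R := sval x.

Definition cpl_eq x y : Prop := forall n, ideal_pow I n (fam x n - fam y n).

Let pow0 n : ideal_pow I n 0. Proof. by case: (ideal_pow_ideal I n). Qed.
Let powD n a b : ideal_pow I n a -> ideal_pow I n b -> ideal_pow I n (a + b).
Proof. by case: (ideal_pow_ideal I n) => _ h _; apply: h. Qed.
Let powM n a b : ideal_pow I n b -> ideal_pow I n (a * b).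
Proof. by case: (ideal_pow_ideal I n) => _ _ h; apply: h. Qed.
Let powN n a : ideal_pow I n a -> ideal_pow I n (- a).
Proof. exact: idealN (ideal_pow_ideal I n). Qed.

Fact cst_cpt (r : R) : compatible (fun=> r).
Proof. by move=> n; rewrite subrr. Qed.
Fact opp_cpt x : compatible (fun n => - fam x n).
Proof. by move=> n; rewrite -opprD; apply/powN/(svalP x). Qed.
Fact add_cpt x y : compatible (fun n => fam x n + fam y n).
Proof.
by move=> n; rewrite opprD addrACA; apply: powD; [apply: (svalP x)|apply: (svalP y)].
Qed.
Fact mul_cpt x y : compatible (fun n => fam x n * fam y n).
Proof.
move=> n; have -> : fam x n.+1 * fam y n.+1 - fam x n * fam y n
  = fam x n.+1 * (fam y n.+1 - fam y n) + fam y n * (fam x n.+1 - fam x n) by ring.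
by apply: powD; apply: powM; [apply: (svalP y)|apply: (svalP x)].
Qed.

Definition cpl_cst (r : R) : compatible_family := exist _ _ (cst_cpt r).
Definition cpl_opp x : compatible_family := exist _ _ (opp_cpt x).
Definition cpl_add x y : compatible_family := exist _ _ (add_cpt x y).
Definition cpl_mul x y : compatible_family := exist _ _ (mul_cpt x y).

Let by_eq x y : fam x =1 fam y -> cpl_eq x y.
Proof. by move=> h n; rewrite h subrr. Qed.

Fact cpl_refl x : cpl_eq x x. Proof. exact: by_eq. Qed.
Fact cpl_sym x y : cpl_eq x y -> cpl_eq y x.
Proof. by move=> h n; rewrite -opprB; apply: powN. Qed.
Fact cpl_trans x y z : cpl_eq x y -> cpl_eq y z -> cpl_eq x z.
Proof.
by move=> h k n; rewrite -[fam x n](subrK (fam y n)) -addrA; apply: powD.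
Qed.
Fact cpl_oppW x y : cpl_eq x y -> cpl_eq (cpl_opp x) (cpl_opp y).
Proof. by move=> h n; rewrite /fam /= -opprD; apply: powN. Qed.
Fact cpl_addW x y z : cpl_eq x y -> cpl_eq (cpl_add x z) (cpl_add y z).
Proof. by move=> h n; rewrite /fam /= opprD addrACA subrr addr0; apply: h. Qed.
Fact cpl_mulW x y z : cpl_eq x y -> cpl_eq (cpl_mul x z) (cpl_mul y z).
Proof. by move=> h n; rewrite /fam /= -mulrBl mulrC; apply: powM. Qed.
Fact cpl_addA x y z :
  cpl_eq (cpl_add x (cpl_add y z)) (cpl_add (cpl_add x y) z).
Proof. by apply: by_eq => n; rewrite /fam /= addrA. Qed.
Fact cpl_addC x y : cpl_eq (cpl_add x y) (cpl_add y x).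
Proof. by apply: by_eq => n; rewrite /fam /= addrC. Qed.
Fact cpl_add0 x : cpl_eq (cpl_add (cpl_cst 0) x) x.
Proof. by apply: by_eq => n; rewrite /fam /= add0r. Qed.
Fact cpl_addN x : cpl_eq (cpl_add (cpl_opp x) x) (cpl_cst 0).
Proof. by apply: by_eq => n; rewrite /fam /= addNr. Qed.
Fact cpl_mulA x y z :
  cpl_eq (cpl_mul x (cpl_mul y z)) (cpl_mul (cpl_mul x y) z).
Proof. by apply: by_eq => n; rewrite /fam /= mulrA. Qed.
Fact cpl_mulC x y : cpl_eq (cpl_mul x y) (cpl_mul y x).
Proof. by apply: by_eq => n; rewrite /fam /= mulrC. Qed.
Fact cpl_mul1 x : cpl_eq (cpl_mul (cpl_cst 1) x) x.
Proof. by apply: by_eq => n; rewrite /fam /= mul1r. Qed.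
Fact cpl_mulD x y z : cpl_eq (cpl_mul (cpl_add x y) z)
                            (cpl_add (cpl_mul x z) (cpl_mul y z)).
Proof. by apply: by_eq => n; rewrite /fam /= mulrDl. Qed.

Definition completion_setoid : setoid_ring :=
  SetoidRing cpl_refl cpl_sym cpl_trans cpl_oppW cpl_addW cpl_mulW
    cpl_addA cpl_addC cpl_add0 cpl_addN cpl_mulA cpl_mulC cpl_mul1 cpl_mulD.

Definition completion : comPzRingType := sr_quot completion_setoid.

Definition completion_map : R -> completion :=
  @sr_class completion_setoid \o cpl_cst.

Fact completion_map_zmod : zmod_morphism completion_map.
Proof. by apply: sr_class_zmod => x y; apply: by_eq. Qed.
Fact completion_map_monoid : monoid_morphism completion_map.
Proof. by apply: sr_class_monoid => [|x y]; apply: by_eq. Qed.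

HB.instance Definition _ := GRing.isZmodMorphism.Build R completion
  completion_map completion_map_zmod.
HB.instance Definition _ := GRing.isMonoidMorphism.Build R completion
  completion_map completion_map_monoid.

End Completion.

(* S as an R-module through f : R -> S. *)
Definition restr_scalars (R S : pzRingType) (f : {rmorphism R -> S}) : Type := S.

Section RestrictionOfScalars.
Variables (R S : pzRingType) (f : {rmorphism R -> S}).
Local Notation M := (restr_scalars f).
HB.instance Definition _ := GRing.Zmodule.copy M S.

Definition restr_scale (a : R) (x : M) : M := f a * (x : S).

Fact restr_scaleA a b x : restr_scale a (restr_scale b x) = restr_scale (a * b) x.
Proof. by rewrite /restr_scale rmorphM mulrA. Qed.
Fact restr_scale1 : left_id 1 restr_scale.
Proof. by move=> x; rewrite /restr_scale rmorph1 mul1r. Qed.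
Fact restr_scaleDr : right_distributive restr_scale +%R.
Proof. by move=> a x y; apply: mulrDr. Qed.
Fact restr_scaleDl x : {morph restr_scale^~ x : a b / a + b}.
Proof. by move=> a b; rewrite /restr_scale rmorphD; apply: mulrDl. Qed.

HB.instance Definition _ := GRing.Zmodule_isLmodule.Build R M
  restr_scaleA restr_scale1 restr_scaleDr restr_scaleDl.
End RestrictionOfScalars.

(* The list of the (m_i, n_i) stands for the sum of the m_i (x) n_i; M (x) N is
   the quotient of the monoid of lists by the congruence tensor_eq.  Opposites
   exist in the quotient, and tensor_nil only kills the class of 0 (x) n. *)
Section Tensor.
Variables (R : pzRingType) (M N : lmodType R).

Inductive tensor_eq : seq (M * N) -> seq (M * N) -> Prop :=
| tensor_refl s : tensor_eq s s
| tensor_sym s t : tensor_eq s t -> tensor_eq t s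
| tensor_trans s t u : tensor_eq s t -> tensor_eq t u -> tensor_eq s u
| tensor_cat s s' t t' :
    tensor_eq s s' -> tensor_eq t t' -> tensor_eq (s ++ t) (s' ++ t')
| tensor_comm s t : tensor_eq (s ++ t) (t ++ s)
| tensor_nil n : tensor_eq [:: (0, n)] [::]
| tensor_addl m m' n : tensor_eq [:: (m + m', n)] [:: (m, n); (m', n)]
| tensor_addr m n n' : tensor_eq [:: (m, n + n')] [:: (m, n); (m, n')]
| tensor_scale a m n : tensor_eq [:: (a *: m, n)] [:: (m, a *: n)].

Definition tensor : Type := cquot tensor_refl tensor_sym tensor_trans.

Definition pure_tensor (m : M) (n : N) : tensor := cclass _ _ _ [:: (m, n)].

Lemma tensor_perm s t : perm_eq s t -> tensor_eq s t.
Proof.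
elim: s t => [|x s IH] t; first by rewrite perm_sym => /perm_nilP ->; constructor.
move=> st; have xt: x \in t by rewrite -(perm_mem st) mem_head.
case/splitPr: xt st => t1 t2 st.
have {}st: perm_eq s (t1 ++ t2).
  by move: st; rewrite perm_sym perm_catC /= perm_cons perm_catC perm_sym.
apply: (@tensor_trans _ ([:: x] ++ (t1 ++ t2))).
  by apply: (@tensor_cat [:: x] [:: x]); [constructor|apply: IH].
rewrite -(cat1s x t2) !catA; apply: tensor_cat; last by constructor.
exact: tensor_comm.
Qed.
End Tensor.

Definition pure_hom (R S : comPzRingType) (f : {rmorphism R -> S}) : Prop :=
  forall M : lmodType R,
    injective (fun m : M => pure_tensor m (1 : restr_scalars f)).

Section TensorAlgebra.
Variables (R A B : comPzRingType).
Variables (f : {rmorphism R -> A}) (g : {rmorphism R -> B}).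
Implicit Types s t u : seq (A * B).

Definition alg_eq s t : Prop :=
  @tensor_eq R (restr_scalars f) (restr_scalars g) s t.
Definition alg_opp s : seq (A * B) := [seq (- x.1, x.2) | x <- s].
Let mulp (x y : A * B) : A * B := (x.1 * y.1, x.2 * y.2).
Definition alg_mul s t : seq (A * B) :=
  [seq (x.1 * y.1, x.2 * y.2) | x <- s, y <- t].

Let cat_eq s s' t t' : alg_eq s s' -> alg_eq t t' -> alg_eq (s ++ t) (s' ++ t').
Proof. exact: tensor_cat. Qed.
Fact alg_refl s : alg_eq s s. Proof. exact: tensor_refl. Qed.
Fact alg_sym s t : alg_eq s t -> alg_eq t s. Proof. exact: tensor_sym. Qed.
Fact alg_trans s t u : alg_eq s t -> alg_eq t u -> alg_eq s u.
Proof. exact: tensor_trans. Qed.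
Let perm s t : perm_eq s t -> alg_eq s t.
Proof. exact: (@tensor_perm _ (restr_scalars f) (restr_scalars g)). Qed.

Fact alg_oppW s t : alg_eq s t -> alg_eq (alg_opp s) (alg_opp t).
Proof.
elim=> {s t} [s|s t _|s t u _ + _|s s' t t' _ + _|s t|n|m m' n|m n n'|a m n].
- exact: alg_refl.
- exact: alg_sym.
- exact: alg_trans.
- by rewrite /alg_opp !map_cat; apply: cat_eq.
- by rewrite /alg_opp !map_cat; apply: tensor_comm.
- rewrite /alg_opp /=.
  have -> : - (0 : restr_scalars f) = 0 by rewrite oppr0.
  exact: (@tensor_nil _ (restr_scalars f) (restr_scalars g)).
- rewrite /alg_opp /= opprD.
  exact: (@tensor_addl _ (restr_scalars f) (restr_scalars g)).
- exact: (@tensor_addr _ (restr_scalars f) (restr_scalars g)).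
- by have := tensor_scale a (- m) n; rewrite scalerN.
Qed.

Let map_eq (h k : A * B -> A * B) t :
  (forall y, alg_eq [:: h y] [:: k y]) -> alg_eq (map h t) (map k t).
Proof.
move=> hk; elim: t => [|y t IH]; first exact: alg_refl.
exact: (@cat_eq [:: h y] [:: k y]).
Qed.

Let map_eq2 (h k l : A * B -> A * B) t :
  (forall y, alg_eq [:: h y] [:: k y; l y]) ->
  alg_eq (map h t) (map k t ++ map l t).
Proof.
move=> hk; elim: t => [|y t IH]; first exact: alg_refl.
apply: alg_trans (@cat_eq [:: h y] _ _ _ (hk y) IH) _.
by apply: perm; rewrite /= perm_cons -cat1s perm_catCA.
Qed.

Let mul_catl s t u : alg_mul (s ++ t) u = alg_mul s u ++ alg_mul t u.
Proof. exact: allpairs_cat. Qed.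

Let mul_seq1 x t : alg_mul [:: x] t = map (mulp x) t.
Proof. exact: allpairs1l. Qed.

Let mul_cons x s t : alg_mul (x :: s) t = map (mulp x) t ++ alg_mul s t.
Proof. by []. Qed.

Fact alg_mulW s t u : alg_eq s t -> alg_eq (alg_mul s u) (alg_mul t u).
Proof.
elim=> {s t} [s|s t _|s t v _ + _|s s' t t' _ + _|s t|n|m m' n|m n n'|a m n].
- exact: alg_refl.
- exact: alg_sym.
- exact: alg_trans.
- by rewrite !mul_catl; apply: cat_eq.
- by rewrite !mul_catl; apply: tensor_comm.
- rewrite (mul_seq1 ((0 : A), (n : B))); elim: u => [|y u IH]; first exact: alg_refl.
  apply: (@cat_eq [:: _] [::]) IH; rewrite /mulp /=.
  have -> : (0 : restr_scalars f) * y.1 = 0 :> A by apply: mul0r.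
  exact: (@tensor_nil _ (restr_scalars f) (restr_scalars g)).
- rewrite (mul_seq1 ((m + m' : A), (n : B))).
  rewrite (mul_cons ((m : A), (n : B))) (mul_seq1 ((m' : A), (n : B))).
  apply: map_eq2 => y; rewrite /mulp /=.
  have -> : (m + m' : A) * y.1 = m * y.1 + m' * y.1 by apply: mulrDl.
  exact: (@tensor_addl _ (restr_scalars f) (restr_scalars g)).
- rewrite (mul_seq1 ((m : A), (n + n' : B))).
  rewrite (mul_cons ((m : A), (n : B))) (mul_seq1 ((m : A), (n' : B))).
  apply: map_eq2 => y; rewrite /mulp /=.
  have -> : (n + n' : B) * y.2 = n * y.2 + n' * y.2 by apply: mulrDl.
  exact: (@tensor_addr _ (restr_scalars f) (restr_scalars g)).
- rewrite (mul_seq1 ((a *: m : A), (n : B))) (mul_seq1 ((m : A), (a *: n : B))).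
  apply: map_eq => y; rewrite /mulp /=.
  have -> : (a *: m : A) * y.1 = f a * ((m : A) * y.1) by rewrite mulrA.
  have -> : (a *: n : B) * y.2 = g a * ((n : B) * y.2) by rewrite mulrA.
  exact: (@tensor_scale _ (restr_scalars f) (restr_scalars g) a (m * y.1 : A)).
Qed.

Fact alg_addW s t u : alg_eq s t -> alg_eq (s ++ u) (t ++ u).
Proof. by move=> h; apply: cat_eq => //; apply: alg_refl. Qed.
Fact alg_addA s t u : alg_eq (s ++ (t ++ u)) ((s ++ t) ++ u).
Proof. by rewrite catA; apply: alg_refl. Qed.
Fact alg_addC s t : alg_eq (s ++ t) (t ++ s).
Proof. exact: tensor_comm. Qed.
Fact alg_add0 s : alg_eq ([::] ++ s) s. Proof. exact: alg_refl. Qed.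

Fact alg_addN s : alg_eq (alg_opp s ++ s) [::].
Proof.
elim: s => [|x s IH]; first exact: alg_refl.
apply: (@alg_trans _ ([:: (- x.1, x.2); x] ++ (alg_opp s ++ s))).
  by apply: perm; rewrite /= perm_cons -cat1s perm_catCA.
apply: (@cat_eq _ [::]) IH; apply: (@alg_trans _ [:: (- x.1 + x.1, x.2)]).
  case: x => a b /=; apply: alg_sym.
  exact: (@tensor_addl _ (restr_scalars f) (restr_scalars g)).
rewrite addNr; exact: (@tensor_nil _ (restr_scalars f) (restr_scalars g)).
Qed.

Fact alg_mulA s t u : alg_eq (alg_mul s (alg_mul t u)) (alg_mul (alg_mul s t) u).
Proof.
suff -> : alg_mul s (alg_mul t u) = alg_mul (alg_mul s t) u by apply: alg_refl.
elim: s => // x s IH; rewrite !mul_cons mul_catl -IH; congr (_ ++ _).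
elim: t {IH} => // y t IH; rewrite map_cons !mul_cons map_cat IH -map_comp.
by congr (_ ++ _); apply: eq_map => z; rewrite /mulp /= !mulrA.
Qed.

Fact alg_mulC s t : alg_eq (alg_mul s t) (alg_mul t s).
Proof.
apply: perm; elim: s => [|x s IH]; first by rewrite /alg_mul allpairs0r.
rewrite mul_cons perm_sym /alg_mul perm_allpairs_consr.
rewrite (@eq_map _ _ _ (mulp x)); first by rewrite perm_cat2l perm_sym.
by move=> y; rewrite /mulp mulrC [X in (_, X)]mulrC.
Qed.

Fact alg_mul1 s : alg_eq (alg_mul [:: (1, 1)] s) s.
Proof.
rewrite mul_seq1 (@eq_map _ _ _ id) ?map_id; first exact: alg_refl.
by case=> a b; rewrite /mulp /= !mul1r.
Qed.

Fact alg_mulD s t u : alg_eq (alg_mul (s ++ t) u) (alg_mul s u ++ alg_mul t u).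
Proof. by rewrite mul_catl; apply: alg_refl. Qed.

Definition tensor_alg_setoid : setoid_ring :=
  SetoidRing alg_refl alg_sym alg_trans alg_oppW alg_addW alg_mulW
    alg_addA alg_addC alg_add0 alg_addN alg_mulA alg_mulC alg_mul1 alg_mulD.

Definition tensor_alg : comPzRingType := sr_quot tensor_alg_setoid.

End TensorAlgebra.

Section FrobeniusNotions.
Variables (R : comNzRingType) (p : nat) (charRp : p \in [pchar R]).

Definition frobenius : {rmorphism R -> R} := pFrobenius_aut charRp.

Definition perfection : comPzRingType := iter_colim frobenius.

Definition F_pure : Prop := pure_hom frobenius.

End FrobeniusNotions.

Definition regular_at (R : comPzRingType) (P : Spec R) : Prop :=
  regular_local (localization P).

Definition regular_ring (R : comPzRingType) : Prop :=
  noetherian R /\ forall P : Spec R, regular_at P.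

(* The residue field at the prime ker g, as a subfield of L. *)
Definition residue_subfield (A : comPzRingType) (L : fieldType)
    (g : {rmorphism A -> L}) : set L :=
  [set x | exists a s : A, g s != 0 /\ x = g a / g s].

Definition finite_over (L : fieldType) (K : set L) : Prop :=
  exists (n : nat) (b : 'I_n -> L), forall x : L,
    exists2 c : 'I_n -> L, (forall i, K (c i)) & x = \sum_(i < n) c i * b i.

(* A field L with a morphism g : A -> L such that L is finite over the residue
   field at ker g is the same as a point q = ker g of Spec A with a finite
   extension L of kappa(q); the ring L (x)_A B is then the base change to L of
   the fibre kappa(q) (x)_A B. *)
Definition geom_regular_fibres (A B : comPzRingType) (f : {rmorphism A -> B}) :
    Prop :=
  forall (L : fieldType) (g : {rmorphism A -> L}),
    finite_over (residue_subfield g) -> regular_ring (tensor_alg g f).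

Definition G_ring (R : comPzRingType) : Prop :=
  noetherian R /\
  forall (P : Spec R) (M : set (localization P)), is_maximal M ->
    geom_regular_fibres (completion_map M).

Definition open_regular_locus (R : comPzRingType) : Prop :=
  exists E : set R, forall P : Spec R, regular_at P <-> ~ (E `<=` sval P).

Definition J2 (R : comPzRingType) : Prop :=
  noetherian R /\
  forall (B : comPzRingType) (f : {rmorphism R -> B}),
    finite_type f -> open_regular_locus B.

Definition universally_catenary (R : comPzRingType) : Prop :=
  noetherian R /\
  forall (B : comPzRingType) (f : {rmorphism R -> B}),
    finite_type f -> catenary B.

Definition excellent (R : comPzRingType) : Prop :=
  [/\ noetherian R, universally_catenary R, G_ring R & J2 R].

(* Main.v *)
From HB Require Import structures.
Require Import Defs.
From mathcomp Require Import all_boot all_algebra.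
From mathcomp Require Import boolp classical_sets.
From mathcomp Require Import ring.

(** Write [A] for the perfection of [R]. An element of [A] is a [p ^ e]-th root
    of an element of [R] ([pth_root e r]), so [A] is the union of the copies
    [R^(1/p^e)] of [R].

    [A] is a GCD domain because each copy is a UFD and because a least common
    multiple computed in [R] stays one after raising everything to the power
    [p ^ e] ([ufd_lcm]), hence also in every larger copy.

    For the rest it is shown that if [A] is coherent, then [R] is both weakly
    F-regular and Cohen-Macaulay. Coherence enters through one statement,
    [coherent_colon_powers]. Let [r] lie outside an ideal [I = (s_1 .. s_n)]
    of [R]. Coherence makes the colon ideal [(I A : r)] finitely generated,
    say by [p ^ e1]-th roots of elements of [R]; F-purity says that ideals of
    [R] are contracted from [A], so the colon ideal is proper and these
    elements lie in the maximal ideal [M]. Taking [p ^ (e + e1)]-th powers,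
    with [q = p ^ (e + e1)], gives
      [(s_1 ^ q .. s_n ^ q) : r ^ q] contained in [M ^ (p ^ e)] for every [e].

    If [r] is in the tight closure of [I], witnessed by [c], then [c] lies in
    all these colon ideals, hence in all powers of [M], and [c = 0] by Krull's
    intersection theorem; so [r] is in [I] after all.

    For Cohen-Macaulayness, let [s] be a maximal regular sequence in [M], of
    length [k]. By maximality some [r] outside [(s)] has [M r] inside [(s)].
    Then [r ^ q] is a torsion element modulo [(s ^ q)], and [R / M ^ (p ^ e)]
    is a quotient of the module it generates there. The torsion of [R / (s ^ q)]
    has length at most [N * q ^ k], since [R / (s ^ q)] is filtered by [q ^ k]
    copies of [R / (s)]. Thus the length of [R / M ^ n] grows no faster than
    [n ^ k], whereas a chain of primes of length [d] forces growth at least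
    [n ^ d] ([prime_chain_len_ge], by the Artin-Rees lemma). So the dimension
    of [R] is at most [k]; conversely a regular sequence of length [n] produces
    a chain of primes of length [n], and dimension and depth agree. *)

Set Implicit Arguments.
Unset Strict Implicit.
Unset Printing Implicit Defensive.

Import GRing.Theory.

Local Open Scope classical_set_scope.
Local Open Scope ring_scope.

(** * Ideals and the maximum condition *)

Section IdealArithmetic.
Variable R : comPzRingType.
Implicit Types (I J K P : set R) (r x y z : R) (s : seq R).

Definition isum I J : set R := [set z | exists2 x, I x & J (z - x)].

Definition addi I x : set R := [set z | exists a, I (z - a * x)].

Definition addl I s : set R := foldl addi I s.

Definition colon I r : set R := [set z | I (z * r)].

(** [r] is a nonzerodivisor modulo [I]. *)
Definition nzd I r : Prop := colon I r `<=` I.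

Lemma ideal0 I : is_ideal I -> I 0. Proof. by case. Qed.

Lemma idealD I x y : is_ideal I -> I x -> I y -> I (x + y).
Proof. by case=> _ h _; apply: h. Qed.

Lemma idealB I x y : is_ideal I -> I x -> I y -> I (x - y).
Proof. by move=> iI Ix Iy; apply: idealD => //; apply: idealN. Qed.

Lemma ideal_mull I x y : is_ideal I -> I y -> I (x * y).
Proof. by case=> _ _; apply. Qed.

Lemma ideal_mulr I x y : is_ideal I -> I x -> I (x * y).
Proof. by rewrite mulrC; apply: ideal_mull. Qed.

Lemma ideal_sum I (T : Type) (t : seq T) (Q : pred T) (F : T -> R) :
  is_ideal I -> (forall i, Q i -> I (F i)) -> I (\sum_(i <- t | Q i) F i).
Proof.
move=> iI IF; elim/big_ind: _ => //; first exact: ideal0.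
by move=> x y; apply: idealD.
Qed.

Lemma ideal_full I : is_ideal I -> I 1 -> I = setT.
Proof.
move=> iI I1; apply/seteqP; split=> // x _.
by rewrite -[x]mulr1; apply: ideal_mull.
Qed.

Lemma ideal_zero : is_ideal [set 0 : R].
Proof. by split=> // [x y -> ->|a x ->]; rewrite /= ?addr0 ?mulr0. Qed.

Lemma isum_ideal I J : is_ideal I -> is_ideal J -> is_ideal (isum I J).
Proof.
move=> iI iJ; split=> [|x y [a Ia Ja] [b Ib Jb]|c x [a Ia Ja]].
- by exists 0; rewrite ?subr0; apply: ideal0.
- exists (a + b); first exact: idealD.
  by rewrite opprD addrACA; apply: idealD.
- by exists (c * a); rewrite -?mulrBr; apply: ideal_mull.
Qed.

Lemma isum_subl I J : is_ideal J -> I `<=` isum I J.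
Proof. by move=> iJ x Ix; exists x; rewrite ?subrr //; apply: ideal0. Qed.

Lemma isum_subr I J : is_ideal I -> J `<=` isum I J.
Proof. by move=> iI x Jx; exists 0; rewrite ?subr0 //; apply: ideal0. Qed.

Lemma isum_sub I J K : is_ideal K -> I `<=` K -> J `<=` K -> isum I J `<=` K.
Proof.
move=> iK IK JK x [a Ia Jxa]; rewrite -(subrK a x).
by apply: idealD; [|apply: JK|apply: IK].
Qed.

Lemma isumSl I J K : I `<=` J -> isum I K `<=` isum J K.
Proof. by move=> IJ x [a Ia Jxa]; exists a => //; apply: IJ. Qed.

Lemma addi_ideal I x : is_ideal I -> is_ideal (addi I x).
Proof.
move=> iI; split=> [|y z [a Ia] [b Ib]|c y [a Ia]].
- by exists 0; rewrite mul0r subr0; apply: ideal0.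
- exists (a + b); have -> : y + z - (a + b) * x = (y - a * x) + (z - b * x) by ring.
  exact: idealD.
- exists (c * a); have -> : c * y - c * a * x = c * (y - a * x) by ring.
  exact: ideal_mull.
Qed.

Lemma addi_sub I x : I `<=` addi I x.
Proof. by move=> y Iy; exists 0; rewrite mul0r subr0. Qed.

Lemma addi_mem I x : is_ideal I -> addi I x x.
Proof. by move=> iI; exists 1; rewrite mul1r subrr; apply: ideal0. Qed.

Lemma addi_min I J x : is_ideal J -> I `<=` J -> J x -> addi I x `<=` J.
Proof.
move=> iJ IJ Jx y [a Ia]; rewrite -(subrK (a * x) y).
by apply: idealD; [|apply: IJ|apply: ideal_mull].
Qed.

Lemma addiC I x y : addi (addi I x) y = addi (addi I y) x.
Proof.
by apply/seteqP; split=> z [a [b h]]; exists b, a; rewrite addrAC.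
Qed.

Lemma addl_ideal I s : is_ideal I -> is_ideal (addl I s).
Proof. by elim: s I => //= x s IH I iI; apply/IH/addi_ideal. Qed.

Lemma addl_sub I s : I `<=` addl I s.
Proof.
by elim: s I => [|x s IH] I //=; apply: subset_trans (IH _); apply: addi_sub.
Qed.

Lemma addl_mem I s x : is_ideal I -> x \in s -> addl I s x.
Proof.
elim: s I => //= y s IH I iI; rewrite inE => /orP [/eqP ->|xs].
  exact/addl_sub/addi_mem.
by apply: IH => //; apply: addi_ideal.
Qed.

Lemma addl_min I J s : is_ideal J -> I `<=` J -> {in s, forall x, J x} ->
  addl I s `<=` J.
Proof.
move=> iJ; elim: s I => [|x s IH] I IJ sJ //=; apply: IH => [|y ys].
  by apply: addi_min => //; apply: sJ; rewrite mem_head.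
by apply: sJ; rewrite inE ys orbT.
Qed.

Lemma addl_addi I s x : addl (addi I x) s = addi (addl I s) x.
Proof. by elim: s I x => //= y s IH I x; rewrite addiC IH. Qed.

Lemma addl_rcons I s x : addl I (rcons s x) = addi (addl I s) x.
Proof. by rewrite -cats1 /addl foldl_cat. Qed.

Lemma ideal_gen_sub (S : set R) : S `<=` ideal_gen S.
Proof. by move=> x Sx I [_ SI]; apply: SI. Qed.

Lemma ideal_gen_min (S : set R) I : is_ideal I -> S `<=` I -> ideal_gen S `<=` I.
Proof. by move=> iI SI x; apply; split. Qed.

Lemma ideal_gen_addl s : ideal_gen [set` s] = addl [set 0] s.
Proof.
apply/seteqP; split.
  have iA := addl_ideal s ideal_zero.
  apply: ideal_gen_min => //.
  by move=> x /= xs; apply: addl_mem => //; apply: ideal_zero.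
apply: addl_min; first exact: ideal_gen_ideal.
  by move=> x /= ->; apply: ideal0 (ideal_gen_ideal _).
by move=> x xs; apply: ideal_gen_sub.
Qed.

Lemma ideal_gen_sumP s x : ideal_gen [set` s] x <->
  exists c : nat -> R, x = \sum_(i < size s) c i * s`_i.
Proof.
split=> [|[c ->]]; last first.
  apply: (ideal_sum _ (ideal_gen_ideal _)) => i _.
  apply: (ideal_mull _ (ideal_gen_ideal _)).
  by apply: ideal_gen_sub; apply: mem_nth.
apply: (@ideal_gen_min _ [set x | exists c : nat -> R,
  x = \sum_(i < size s) c i * s`_i]).
  split=> [|y z [c ->] [d ->]|a y [c ->]].
  - by exists (fun=> 0); rewrite big1 // => i _; rewrite mul0r.
  - exists (fun i => c i + d i); rewrite -big_split /=.
    by apply: eq_bigr => i _; rewrite mulrDl.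
  - exists (fun i => a * c i); rewrite mulr_sumr.
    by apply: eq_bigr => i _; rewrite mulrA.
move=> y /= ys; exists (fun i => (i == index y s)%:R).
have ij : (index y s < size s)%N by rewrite index_mem.
rewrite (bigD1 (Ordinal ij)) //= eqxx mul1r nth_index // big1 ?addr0 // => i ne.
by rewrite -val_eqE /= in ne; rewrite (negbTE ne) mul0r.
Qed.

Lemma ideal_gen1P r x : ideal_gen [set r] x <-> exists a, x = a * r.
Proof.
split=> [|[a ->]]; last first.
  by apply: (ideal_mull _ (ideal_gen_ideal _)); apply: ideal_gen_sub.
apply: (@ideal_gen_min _ [set x | exists a, x = a * r]).
  split=> [|_ _ [a ->] [b ->]|b _ [a ->]]; first by exists 0; rewrite mul0r.
    by exists (a + b); rewrite mulrDl.
  by exists (b * a); rewrite mulrA.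
by move=> y /= ->; exists 1; rewrite mul1r.
Qed.

Lemma colon_ideal I r : is_ideal I -> is_ideal (colon I r).
Proof.
move=> iI; split=> [|x y|a x]; rewrite /colon /=.
- by rewrite mul0r; apply: ideal0.
- by rewrite mulrDl; apply: idealD.
- by rewrite -mulrA; apply: ideal_mull.
Qed.

(** A strictly increasing sequence, obtained by choice if there is no maximal
    element, would have a union that is not finitely generated. *)
Lemma noetherian_max : noetherian R -> forall (C : set (set R)),
  (forall I, C I -> is_ideal I) -> (exists I, C I) ->
  exists2 I, C I & forall J, C J -> I `<=` J -> J = I.
Proof.
move=> noeth C Cid [I0 CI0]; apply: contrapT => nomax.
have step (X : {I | C I}) : exists Y : {I | C I}, sval X `<` sval Y.
  case: X => I CI; apply: contrapT => h; apply: nomax; exists I => // J CJ IJ.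
  apply: contrapT => ne; apply: h; exists (exist _ J CJ) => /=.
  by split=> // JI; apply: ne; apply/seteqP.
have [f fP] := choice step.
pose u n : set R := sval (iter n f (exist _ I0 CI0)).
have uid n : is_ideal (u n) by apply: Cid; rewrite /u; case: (iter _ _ _).
have uS n : u n `<` u n.+1 by apply: fP.
have umono m n : (m <= n)%N -> u m `<=` u n.
  by elim: n => [|n IH]; [rewrite leqn0 => /eqP ->|
    rewrite leq_eqVlt => /orP [/eqP -> //|/IH h]; apply: subset_trans h _; case: (uS n)].
pose U : set R := [set x | exists n, u n x].
have iU : is_ideal U.
  split=> [|x y [m um] [n un]|a x [n un]]; first by exists 0%N; apply: ideal0.
    exists (maxn m n); apply: idealD => //.
      by apply: umono um; apply: leq_maxl.
    by apply: umono un; apply: leq_maxr.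
  by exists n; apply: ideal_mull.
have [s Us] := noeth U iU.
have [n un] : exists n, {in s, forall x, u n x}.
  have : {in s, forall x, U x} by move=> x xs; rewrite Us; apply: ideal_gen_sub.
  elim: (s) => [|x t IH] tU; first by exists 0%N.
  have [n un] := IH (fun y yt => tU y (mem_behead (s := x :: t) yt)).
  have [m um] := tU x (mem_head _ _).
  exists (maxn m n) => y; rewrite inE => /orP [/eqP ->|/un].
    by apply: umono um; apply: leq_maxl.
  by apply: umono; apply: leq_maxr.
case: (uS n) => _; apply; apply: (@subset_trans _ U); first by move=> x; exists n.+1.
by rewrite Us; apply: ideal_gen_min.
Qed.

Section Noetherian.
Hypothesis noeth : noetherian R.

(** An ideal maximal among those that contain [I] and miss [S] is prime. *)
Lemma prime_avoiding I (S : set R) : is_ideal I -> S 1 ->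
  (forall x y, S x -> S y -> S (x * y)) -> (forall x, I x -> ~ S x) ->
  exists P, [/\ is_prime P, I `<=` P & forall x, P x -> ~ S x].
Proof.
move=> iI S1 SM IS.
have [|P [iP IP PS] Pmax] := @noetherian_max noeth [set J | [/\ is_ideal J, I `<=` J &
    forall x, J x -> ~ S x]] (fun J => fun '(And3 h _ _) => h).
  by exists I; split.
exists P; split=> //; split=> //; first by move=> /PS.
move=> x y Pxy; apply: contrapT => /not_orP [nx ny].
have meets z : ~ P z -> exists2 t, S t & addi P z t.
  move=> nz; apply: contrapT => h; apply: nz.
  rewrite -(Pmax (addi P z)); [exact: addi_mem| |exact: addi_sub].
  split; [exact: addi_ideal|exact: subset_trans IP (@addi_sub _ _)|].
  by move=> t Pt St; apply: h; exists t.
have [s Ss [a Pa]] := meets x nx; have [t St [b Pb]] := meets y ny.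
apply: (PS (s * t)); last exact: SM.
have -> : s * t = (s - a * x) * t + a * x * (t - b * y) + a * b * (x * y) by ring.
apply: idealD => //; last exact: ideal_mull.
by apply: idealD => //; [apply: ideal_mulr|apply: ideal_mull].
Qed.

End Noetherian.
End IdealArithmetic.

(** * Powers of ideals, Hilbert's basis theorem and the Artin-Rees lemma *)

Section IdealPowers.
Variables (R : comPzRingType) (I : set R).
Hypothesis iI : is_ideal I.

Lemma ideal_powS n x y : I x -> ideal_pow I n y -> ideal_pow I n.+1 (x * y).
Proof. by move=> Ix Iy; apply: ideal_gen_sub; exists x, y. Qed.

Lemma ideal_powW m n : (m <= n)%N -> ideal_pow I n `<=` ideal_pow I m.
Proof.
elim: n => [|n IH]; first by rewrite leqn0 => /eqP ->.
rewrite leq_eqVlt => /orP [/eqP -> //|/IH h]; apply: subset_trans h.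
apply: ideal_gen_min; first exact: ideal_pow_ideal.
by move=> _ [x [y [_ Iy ->]]]; apply: (ideal_mull _ (ideal_pow_ideal _ _)).
Qed.

Lemma ideal_pow_exp n x : I x -> ideal_pow I n (x ^+ n).
Proof. by move=> Ix; elim: n => // n IH; rewrite exprS; apply: ideal_powS. Qed.

Lemma ideal_pow_sub n : (0 < n)%N -> ideal_pow I n `<=` I.
Proof.
case: n => // n _; apply: ideal_gen_min => // _ [x [y [Ix _ ->]]].
exact: ideal_mulr.
Qed.

End IdealPowers.

(** Build a list [s] of elements of the ideal, adding each time an element of
    least size outside the ideal generated so far, and stop when the ideal of
    leading coefficients is maximal. An element of least size outside [(s)] then
    has its leading term cancelled by [s], which produces a smaller one. *)
Theorem hilbert_basis (S : comNzRingType) : noetherian S -> noetherian {poly S}.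
Proof.
move=> noeth I iI; apply: contrapT => nfg.
pose good (s : seq {poly S}) := {in s, forall g : {poly S}, I g} /\
  forall f, I f -> ~ ideal_gen [set` s] f ->
    {in s, forall g : {poly S}, (size g <= size f)%N}.
have [||_ [s [sI sz] ->] smax] := @noetherian_max S noeth
  [set J | exists2 s, good s & J = ideal_gen [set` map lead_coef s]].
- by move=> _ [s _ ->]; apply: ideal_gen_ideal.
- by exists (ideal_gen [set` [::]]), [::].
have sub : ideal_gen [set` s] `<=` I by apply: ideal_gen_min.
have [f [If nf fmin]] : exists f, [/\ I f, ~ ideal_gen [set` s] f &
    forall g, I g -> ~ ideal_gen [set` s] g -> (size f <= size g)%N].
  have ex : exists n, `[< exists f, [/\ I f, ~ ideal_gen [set` s] f & size f = n] >].
    apply: contrapT => h; apply: nfg; exists s; apply/seteqP; split=> // f If.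
    by apply: contrapT => nf; apply: h; exists (size f); apply/asboolP; exists f.
  have [_ /asboolP [f [If nf <-]] fmin] := ex_minnP ex.
  by exists f; split=> // g Ig ng; apply: fmin; apply/asboolP; exists g.
have rs : good (rcons s f).
  split=> [g|g Ig ng h]; first by rewrite mem_rcons inE => /orP [/eqP ->|/sI].
  have ngs : ~ ideal_gen [set` s] g.
    move=> sg; apply: ng; apply: ideal_gen_min sg; first exact: ideal_gen_ideal.
    by move=> k /= ks; apply: ideal_gen_sub; rewrite /= mem_rcons inE ks orbT.
  by rewrite mem_rcons inE => /orP [/eqP ->|hs]; [apply: fmin|apply: sz].
have eqJ : ideal_gen [set` map lead_coef (rcons s f)] =
           ideal_gen [set` map lead_coef s].
  apply: smax; first by exists (rcons s f).
  apply: ideal_gen_min; first exact: ideal_gen_ideal.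
  by move=> k /= ks; apply: ideal_gen_sub; rewrite /= map_rcons mem_rcons inE ks orbT.
have : ideal_gen [set` map lead_coef s] (lead_coef f).
  rewrite -eqJ; apply: ideal_gen_sub => /=.
  by rewrite map_rcons mem_rcons mem_head.
move=> /ideal_gen_sumP [c lf]; rewrite size_map in lf.
pose d := size f.
(* The combination of [s] that has the leading term of [f]. *)
pose g := \sum_(i < size s) (c i)%:P * 'X^(d - size s`_i) * s`_i.
have sg : ideal_gen [set` s] g
  by apply/ideal_gen_sumP; exists (fun i => (c i)%:P * 'X^(d - size s`_i)).
have f0 : f != 0.
  by apply/eqP => f0; apply: nf; rewrite f0; apply: ideal0 (ideal_gen_ideal _).
have d0 : (0 < d)%N by rewrite size_poly_gt0.
have si (i : 'I_(size s)) : (size (s`_i)%R <= d)%N.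
  by apply: (sz f If nf); apply: mem_nth.
have szg : (size (f - g)%R <= d)%N.
  rewrite (leq_trans (size_polyD _ _)) // geq_max leqnn size_polyN /=.
  apply: (leq_trans (size_sum _ _ _)); apply/bigmax_leqP => i _.
  rewrite -mulrA mul_polyC (leq_trans (size_scale_leq _ _)) // mulrC.
  have [->|nz] := eqVneq s`_i 0; first by rewrite mul0r size_poly0.
  by rewrite size_mulXn // subnK.
have cg : (f - g)`_d.-1 = 0.
  rewrite coefB [f`__]lf coef_sum; apply/eqP; rewrite subr_eq0; apply/eqP.
  apply: eq_bigr => i _; rewrite -mulrA coefCM mulrC [in RHS]mulrC; congr (_ * _).
  rewrite (nth_map 0) // mulrC coefMXn lead_coefE.
  have := si i; case: (size s`_i) (nth_default 0 (leqnn (size s`_i))) => [h _|k _ kd].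
    by rewrite subn0 prednK // leqnn h.
  have e : (d - k.+1 + k = d.-1)%N by rewrite -[in RHS](subnK kd) addnS.
  by rewrite -e ltnNge leq_addr /= addKn.
have ng : ~ ideal_gen [set` s] (f - g).
  move=> h; apply: nf; rewrite -(subrK g f).
  exact: idealD (ideal_gen_ideal _) h sg.
have : (d <= size (f - g)%R)%N by apply: fmin ng; apply: idealB => //; apply: sub.
rewrite leq_eqVlt ltnNge szg orbF => /eqP e.
have : lead_coef (f - g) = 0 by rewrite lead_coefE -e.
by move/eqP; rewrite lead_coef_eq0 => /eqP fg; apply: ng; rewrite fg;
  apply: ideal0 (ideal_gen_ideal _).
Qed.

Section ArtinRees.
Variables (R : comNzRingType) (I : set R).
Hypotheses (noeth : noetherian R) (iI : is_ideal I).

(** The Rees ring [R[I X]] is a quotient of a polynomial ring over [R]. It is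
    encoded as the range of a morphism to [R[X]], which allows adjoining the
    generators [w X] one variable at a time. *)
Lemma rees_noetherian (ws : seq R) : {in ws, forall w, I w} ->
  exists (S : comNzRingType) (phi : {rmorphism S -> {poly R}}),
    [/\ noetherian S, forall c, range phi c%:P,
        {in ws, forall w : R, range phi (w *: 'X)}
      & forall f i, ideal_pow I i (phi f)`_i].
Proof.
elim: ws => [|w ws IH] wsI.
  exists R, polyC; split; [by []|by move=> c; exists c|by []|move=> f i].
  rewrite coefC; case: eqP => [-> //|_]; exact: ideal0 (ideal_pow_ideal _ _).
have [|S [phi [nS phiC phiX phiI]]] := IH.
  by move=> x xs; apply: wsI; rewrite inE xs orbT.
have cw : commr_rmorph phi (w *: 'X) by move=> x; apply: mulrC.
exists {poly S}, (horner_morph cw); split.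
- exact: hilbert_basis.
- move=> c; have [r _ <-] := phiC c.
  by exists r%:P => //; rewrite /= horner_morphC.
- move=> x; rewrite inE => /orP [/eqP ->|xs].
    by exists 'X => //; rewrite /= horner_morphX.
  by have [r _ <-] := phiX x xs; exists r%:P => //; rewrite /= horner_morphC.
elim/poly_ind => [|f c IHf] i.
  by rewrite rmorph0 coef0; apply: ideal0 (ideal_pow_ideal _ _).
rewrite rmorphD rmorphM /= horner_morphC horner_morphX coefD.
apply: (idealD (ideal_pow_ideal _ _)) => //.
rewrite -scalerAr coefZ coefMX; case: i => [//|i] /=.
by apply: ideal_powS (IHf i); apply: wsI; rewrite mem_head.
Qed.

(** In the Rees ring, the polynomials with all coefficients in [P + y R] form
    an ideal, generated by finitely many polynomials of degree at most [b].
    Expanding [u X^(n+b)], for [u] in [I^(n+b)] and in [P + y R], in these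
    generators puts [u] into [y I^n + P]; and [y] can be cancelled. *)
Theorem artin_rees (P : set R) (y : R) : is_ideal P -> nzd P y ->
  exists b, forall n, colon (isum P (ideal_pow I (n + b))) y
    `<=` isum P (ideal_pow I n).
Proof.
move=> iP Py; have [ws Iws] := noeth iI.
have wsI : {in ws, forall w, I w} by move=> w h; rewrite Iws; apply: ideal_gen_sub.
have [S [phi [nS phiC phiX phiI]]] := rees_noetherian wsI.
have phiD u v : range phi u -> range phi v -> range phi (u + v).
  by move=> [f _ <-] [g _ <-]; exists (f + g); rewrite ?rmorphD.
have phiM u v : range phi u -> range phi v -> range phi (u * v).
  by move=> [f _ <-] [g _ <-]; exists (f * g); rewrite ?rmorphM.
have rees n u : ideal_pow I n u -> range phi (u *: 'X^n).
  elim: n u => [|n IH] u; first by rewrite alg_polyC => _; apply: phiC.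
  have iJ : is_ideal [set v : R | range phi (v *: 'X^(n.+1))].
    split=> [|v w hv hw|a v hv]; rewrite /= ?scale0r.
    - by rewrite -[0]/(0%:P); apply: phiC.
    - by rewrite scalerDl; apply: phiD.
    - by rewrite -scalerA -mul_polyC; apply: phiM.
  apply: (ideal_gen_min iJ) => _ [v [w [Iv Iw ->]]] /=.
  have -> : (v * w) *: 'X^(n.+1) = (v *: 'X) * (w *: 'X^n) :> {poly R}.
    by rewrite -scalerAl -scalerAr scalerA exprS.
  apply: (phiM _ _ _ (IH _ Iw)); move: Iv; rewrite Iws.
  have iK : is_ideal [set v : R | range phi (v *: 'X)].
    split=> [|u1 u2 h1 h2|a u1 h1]; rewrite /= ?scale0r.
    - by rewrite -[0]/(0%:P); apply: phiC.
    - by rewrite scalerDl; apply: phiD.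
    - by rewrite -scalerA -mul_polyC; apply: phiM.
  by apply: (ideal_gen_min iK) => t ts; apply: phiX.
pose U : set S := [set f | forall i, addi P y (phi f)`_i].
have iPy := addi_ideal y iP.
have iU : is_ideal U.
  split=> [i|f g Uf Ug i|a f Uf i].
  - by rewrite rmorph0 coef0; apply: ideal0.
  - by rewrite rmorphD coefD; apply: idealD.
  - rewrite rmorphM coefM; apply: (ideal_sum _ iPy) => j _.
    exact: ideal_mull.
have [fs Ufs] := nS U iU.
exists (\max_(f <- fs) size (phi f)) => n z; rewrite /colon /=.
set b := \max_(f <- fs) _.
case=> q Pq Ib; have [f _ fE] := rees _ _ Ib.
have : U f.
  move=> i; rewrite fE coefZ coefXn; case: eqP => _; last by rewrite mulr0; apply: ideal0.
  by exists z; rewrite mulr1 addrAC subrr sub0r; apply: idealN.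
rewrite Ufs => /ideal_gen_sumP [c fsum].
have fsb (k : 'I_(size fs)) j : (b < j)%N -> (phi fs`_k)`_j = 0.
  move=> bj; apply: nth_default; apply: leq_trans (ltnW bj).
  rewrite /b (big_nth 0) big_mkord.
  exact: (leq_bigmax_cond (F := fun k : 'I_(size fs) => size (phi (fs`_k)%R))).
have vP (k : 'I_(size fs)) : forall j, exists v, P ((phi fs`_k)`_j - v * y).
  by have : U fs`_k by rewrite Ufs; apply: ideal_gen_sub; apply: mem_nth.
have [v vE] : exists v : 'I_(size fs) -> nat -> R,
    forall (k : 'I_(size fs)) j, P ((phi fs`_k)`_j - v k j * y).
  by exists (fun k => projT1 (choice (vP k))) => k j; case: (choice _).
have e : z * y - q = \sum_(k < size fs) \sum_(j < (n + b).+1)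
    (phi (c k))`_(n + b - j) * (phi fs`_k)`_j.
  have -> : z * y - q = (phi f)`_(n + b) by rewrite fE coefZ coefXn eqxx mulr1.
  rewrite fsum rmorph_sum coef_sum; apply: eq_bigr => k _.
  by rewrite rmorphM coefMr.
(* Terms with [j > b] vanish; in the others the first factor is in [I^n]. *)
pose w := \sum_(k < size fs) \sum_(j < (n + b).+1 | (j <= b)%N)
    (phi (c k))`_(n + b - j) * v k j.
have Iw : ideal_pow I n w.
  apply: (ideal_sum _ (ideal_pow_ideal _ _)) => k _.
  apply: (ideal_sum _ (ideal_pow_ideal _ _)) => j jb.
  apply: (ideal_mulr _ (ideal_pow_ideal _ _)).
  by apply: ideal_powW (phiI _ _); rewrite -addnBA // leq_addr.
exists (z - w); last by rewrite opprB addrC subrK.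
apply: Py; rewrite /colon /= mulrBl.
have -> : z * y - w * y = q + (z * y - q - w * y) by ring.
apply: idealD => //; rewrite e mulr_suml -sumrB; apply: (ideal_sum _ iP) => k _.
rewrite mulr_suml [X in _ - X]big_mkcond -sumrB.
apply: (ideal_sum _ iP) => j _ /=; case: ifP => [jb|/negbT]; last first.
  by rewrite -ltnNge => /fsb ->; rewrite mulr0 subrr; apply: ideal0.
by rewrite -mulrA -mulrBr; apply: ideal_mull.
Qed.

End ArtinRees.

(** * Lengths of chains of ideals *)

Section Length.
Variable R : comPzRingType.
Implicit Types (I J K X Y M : set R) (r x y z : R) (s : seq R).

(** There is a strictly increasing chain of [n] steps of ideals starting at [I]
    and ending inside [J]. Lower and upper bounds [len_ge] and [len_le] for the
    length of [J / I] suffice below; additivity of lengths then becomes the two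
    inequalities [len_ge_cat] and [len_le_split]. *)
Fixpoint len_ge I J n : Prop :=
  if n is n'.+1 then exists K, [/\ is_ideal K, I `<` K & len_ge K J n']
  else I `<=` J.

Definition len_le I J N : Prop := forall n, len_ge I J n -> (n <= N)%N.

Lemma len_ge_sub I J n : len_ge I J n -> I `<=` J.
Proof.
elim: n I => [|n IH] I //= [K [_ [IK _] /IH]]; exact: subset_trans.
Qed.

Lemma len_geS I I' J J' n : I' `<=` I -> J `<=` J' ->
  len_ge I J n -> len_ge I' J' n.
Proof.
move=> II JJ; elim: n I I' II => [|n IH] I I' II /=.
  by move=> IJ; apply: subset_trans JJ; apply: subset_trans IJ.
case=> K [iK [IK KI] h]; exists K; split=> //; last exact: IH h.
split; first exact: subset_trans IK.
by move=> KI'; apply: KI; apply: subset_trans II.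
Qed.

Lemma len_ge_cat I J K m n : len_ge I J m -> len_ge J K n -> len_ge I K (m + n).
Proof.
elim: m I => [|m IH] I /=; first by move=> IJ; apply: len_geS.
by move=> [L [iL IL h]] h'; exists L; split=> //; apply: IH.
Qed.

Lemma len_ge_map (phi : set R -> set R) I J n : is_ideal I ->
  (forall X, is_ideal X -> is_ideal (phi X)) ->
  (forall X Y, X `<=` Y -> phi X `<=` phi Y) ->
  (forall X Y, is_ideal X -> is_ideal Y -> I `<=` X -> X `<=` Y -> Y `<=` J ->
     phi Y `<=` phi X -> Y `<=` X) ->
  len_ge I J n -> len_ge (phi I) (phi J) n.
Proof.
move=> iI phiI phiS phiX; suff h X : is_ideal X -> I `<=` X ->
    len_ge X J n -> len_ge (phi X) (phi J) n by apply: h.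
elim: n X => [|n IH] X iX IX /=; first exact: phiS.
case=> K [iK [XK KX] h]; exists (phi K); split; first exact: phiI.
  split; first exact: phiS.
  by move=> phiKX; apply: KX; apply: phiX (len_ge_sub h) phiKX.
by apply: IH => //; apply: subset_trans XK.
Qed.

(** By Dedekind's modular law, each step of a chain remains proper either
    after intersection with [J] or after adding [J]. *)
Lemma len_ge_split I J K n : is_ideal I -> is_ideal J -> len_ge I K n ->
  exists a b, [/\ (n <= a + b)%N, len_ge (I `&` J) (K `&` J) a
                & len_ge (isum I J) (isum K J) b].
Proof.
move=> iI iJ; elim: n I iI => [|n IH] I iI /=.
  by move=> IK; exists 0%N, 0%N; split=> //=; [apply: setSI|apply: isumSl].
case=> L [iL [IL LI] h]; have [a [b [nab ha hb]]] := IH L iL h.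
have [capS|capE] := pselect (I `&` J `<` L `&` J).
  exists a.+1, b; split; [by []| |exact: len_geS (isumSl IL) _ hb].
  exists (L `&` J); split=> //; split=> [|x y [Lx Jx] [Ly Jy]|c x [Lx Jx]].
  - by split; apply: ideal0.
  - by split; apply: idealD.
  - by split; apply: ideal_mull.
exists a, b.+1; split; first by rewrite addnS.
  exact: len_geS (setSI IL) _ ha.
exists (isum L J); split=> //; first exact: isum_ideal.
split=> [|sumE]; first exact: isumSl.
apply: LI => z Lz; have [x Ix Jzx] : isum I J z by apply/sumE/isum_subl.
have LJ : (L `&` J) (z - x) by split=> //; apply: idealB => //; apply: IL.
have IJ : (I `&` J) (z - x).
  apply: contrapT => nI; apply: capE; split; first exact: setSI.
  by move=> h'; apply/nI/h'.
by rewrite -(subrK x z); apply: idealD => //; case: IJ.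
Qed.

Lemma len_le_split I J K a b : is_ideal I -> is_ideal J ->
  len_le (I `&` J) (K `&` J) a -> len_le (isum I J) (isum K J) b ->
  len_le I K (a + b).
Proof.
move=> iI iJ ha hb n /(len_ge_split iI iJ) [a' [b' [le /ha la /hb lb]]].
by apply: leq_trans le _; apply: leq_add.
Qed.

Lemma len_leS I I' J J' N : I `<=` I' -> J' `<=` J ->
  len_le I J N -> len_le I' J' N.
Proof. by move=> II JJ h n /(len_geS II JJ) /h. Qed.

(** For finitely generated [M], [saturation M I / I] is the [M]-power torsion of
    [R / I], that is, its zeroth local cohomology. *)
Definition saturation M I : set R :=
  [set z | forall w, M w -> exists n, I (w ^+ n * z)].

Lemma saturation_sub M I : I `<=` saturation M I.
Proof. by move=> z Iz w _; exists 0%N; rewrite mul1r. Qed.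

Lemma saturationS M I J : I `<=` J -> saturation M I `<=` saturation M J.
Proof. by move=> IJ z h w /h [n In]; exists n; apply: IJ. Qed.

Lemma saturation_ideal M I : is_ideal I -> is_ideal (saturation M I).
Proof.
move=> iI; split=> [w _|x y hx hy w Mw|a x hx w Mw].
- by exists 0%N; rewrite mulr0; apply: ideal0.
- have [[m hm] [n hn]] := conj (hx w Mw) (hy w Mw); exists (m + n)%N.
  rewrite mulrDr exprD; apply: idealD => //.
    by rewrite mulrAC; apply: ideal_mulr.
  by rewrite -mulrA; apply: ideal_mull.
- by have [n hn] := hx w Mw; exists n; rewrite mulrCA; apply: ideal_mull.
Qed.

(** [(I + g R) / I] is a cyclic module over the field [R / M]. *)
Lemma len_le_socle M I g : is_ideal I ->
  (forall a, ~ M a -> exists b, M (1 - b * a)) ->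
  (forall w, M w -> I (w * g)) -> len_le I (addi I g) 1.
Proof.
move=> iI maxM Mg [|[|n]] // [K [iK [IK KI] [L [_ [KL LK] /len_ge_sub LI]]]].
case: LK; apply: (subset_trans LI); apply: addi_min => //.
have [k Kk nk] : exists2 k, K k & ~ I k.
  by apply: contrapT => h; apply: KI => k Kk; apply: contrapT => nk; apply: h; exists k.
have [a Ia] : addi I g k by apply/LI/KL.
have na : ~ M a.
  by move=> /Mg Iag; apply: nk; rewrite -(subrK (a * g) k); apply: idealD.
have [b /Mg Ib] := maxM a na.
(* [g] is congruent to a multiple of [k] modulo [I], as [1 - b * a] kills it. *)
have -> : g = (1 - b * a) * g - b * (k - a * g) + b * k by ring.
apply: idealD => //; first by apply: idealB => //; apply: IK; [|apply: ideal_mull].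
exact: ideal_mull.
Qed.

(** Noetherian induction on [I]: as long as there is torsion there is a socle
    element [g], chosen with the largest annihilator [(J : g)], and passing from
    [J] to [J + g R] costs one step. *)
Lemma saturation_finite M I : noetherian R -> is_ideal I ->
  (forall a, ~ M a -> exists b, M (1 - b * a)) ->
  exists N, len_le I (saturation M I) N.
Proof.
move=> noeth iI maxM; apply: contrapT => nI.
have [||J [iJ nJ] Jmax] := @noetherian_max _ noeth
  [set J | is_ideal J /\ ~ exists N, len_le J (saturation M J) N].
- by move=> J [].
- by exists I.
have [g0 Sg0 nJg0] : exists2 g, saturation M J g & ~ J g.
  apply: contrapT => h; apply: nJ; exists 0%N => -[|n] // [K [_ [JK KJ] /len_ge_sub KS]].
  case: KJ; apply: subset_trans KS _ => g Sg.
  by apply: contrapT => ng; apply: h; exists g.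
have [||C [g [Sg nJg Cg]] Cmax] := @noetherian_max _ noeth
  [set C | exists g, [/\ saturation M J g, ~ J g & C = colon J g]].
- by move=> _ [g [_ _ ->]]; apply: colon_ideal.
- by exists (colon J g0), g0.
have Mg w : M w -> J (w * g).
  move=> Mw; apply: contrapT => nw.
  have ex : exists n, `[< J (w ^+ n * g) >].
    by have [n h] := Sg w Mw; exists n; apply/asboolP.
  have [n /asboolP Jn nmin] := ex_minnP ex.
  case: n Jn nmin => [|n] Jn nmin; first by apply: nJg; rewrite -[g]mul1r.
  have nJn : ~ J (w ^+ n * g) by move=> /asboolP /nmin; rewrite ltnn.
  (* By minimality of [n.+1], [w ^+ n * g] is another torsion element outside [J]
     whose annihilator contains the maximal one, [C]. *)
  have E : colon J (w ^+ n * g) = C.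
    apply: Cmax; last first.
      by rewrite Cg => z Jz; rewrite /colon /= mulrCA; apply: ideal_mull.
    exists (w ^+ n * g); split=> //.
    exact: (ideal_mull _ (saturation_ideal M iJ)).
  have : C w by rewrite -E /colon /= mulrA -exprS.
  by rewrite Cg.
apply: nJ.
have iJg := addi_ideal g iJ.
have [N hN] : exists N, len_le (addi J g) (saturation M (addi J g)) N.
  apply: contrapT => h; apply: nJg.
  rewrite -(Jmax (addi J g)); [exact: addi_mem|by []|exact: addi_sub].
exists (1 + N)%N; apply: (len_le_split (J := addi J g)) => //.
  apply: (len_leS _ _ (len_le_socle iJ maxM Mg)); last by move=> ? [].
  by move=> z Jz; split=> //; apply: addi_sub.
apply: len_leS hN; first exact: isum_subr.
apply: isum_sub; first exact: saturation_ideal.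
  by apply: saturationS; apply: addi_sub.
exact: saturation_sub.
Qed.

(** A relation [z x = i + b y] makes [b] a multiple of [x] modulo [I], after
    which [x] can be cancelled. *)
Lemma nzd_swap I x y : is_ideal I -> nzd I x -> nzd (addi I x) y ->
  nzd (addi I y) x.
Proof.
move=> iI Ix Iy z [b Iz].
have [|c Ic] := Iy b.
  by exists z; rewrite -opprB; apply: idealN.
exists c; apply: Ix; rewrite /colon /=.
have -> : (z - c * y) * x = (z * x - b * y) + y * (b - c * x) by ring.
by apply: idealD => //; apply: ideal_mull.
Qed.

Lemma nzd_exp I x n : nzd I x -> nzd I (x ^+ n).
Proof.
move=> Ix; elim: n => [|n IH] z; rewrite /colon /= ?mulr1 // exprS mulrA => h.
by apply/Ix/IH.
Qed.

Lemma nzd_addi_exp I x y n : is_ideal I -> nzd I x -> nzd (addi I x) y ->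
  nzd (addi I (x ^+ n)) y.
Proof.
move=> iI Ix Iy; elim: n => [|n IH] z.
  by exists z; rewrite mulr1 subrr; apply: ideal0.
case=> b Ib.
have [|c Ic] := Iy z.
  by exists (b * x ^+ n); rewrite -mulrA -exprSr.
have [|d Id] := IH c.
  exists b; apply: Ix; rewrite /colon /=.
  have -> : (c * y - b * x ^+ n) * x = (z * y - b * x ^+ n.+1) - y * (z - c * x).
    by rewrite exprS; ring.
  by apply: idealB => //; apply: ideal_mull.
exists d; have -> : z - d * x ^+ n.+1 = (z - c * x) + x * (c - d * x ^+ n).
  by rewrite exprS; ring.
by apply: idealD => //; apply: ideal_mull.
Qed.

(** Regularity on [R / I], by recursion on the head with the ideal as a
    parameter; [regular_seqP] compares it with [regular_seq]. *)
Fixpoint regseq I s : Prop :=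
  if s is x :: s' then nzd I x /\ regseq (addi I x) s' else True.

Lemma regseq_addi_exp I x s n : is_ideal I -> nzd I x ->
  regseq (addi I x) s -> regseq (addi I (x ^+ n)) s.
Proof.
elim: s I => //= y s IH I iI Ix [Iy ys]; split; first exact: nzd_addi_exp.
rewrite addiC; apply: IH; [exact: addi_ideal|exact: nzd_swap|].
by rewrite addiC.
Qed.

(** The head of a regular sequence can be moved past the rest, even when the
    rest is replaced by powers. *)
Lemma nzd_past_regseq I x s n : is_ideal I -> nzd I x -> regseq (addi I x) s ->
  nzd (addl I [seq y ^+ n | y <- s]) x.
Proof.
elim: s I => //= y s IH I iI Ix [Iy ys]; apply: IH; first exact: addi_ideal.
  by apply: nzd_swap => //; apply: nzd_exp.
rewrite addiC; apply: regseq_addi_exp => //; exact: addi_ideal.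
Qed.

(** Left exactness of torsion on
    [0 -> R/(I + x^n) -> R/(I + x^(n+1)) -> R/(I + x) -> 0], where the first map
    is multiplication by [x]. *)
Lemma len_le_saturation_exp M I x N n : is_ideal I -> nzd I x ->
  len_le (addi I x) (saturation M (addi I x)) N ->
  len_le (addi I (x ^+ n)) (saturation M (addi I (x ^+ n))) (n * N).
Proof.
move=> iI Ix hN; have iJ := addi_ideal x iI.
elim: n => [|n IH].
  move=> [|n] // [K [_ [_ KI] _]]; case: KI => z _.
  by exists z; rewrite mulr1 subrr; apply: ideal0.
have iK := addi_ideal (x ^+ n.+1) iI.
have KJ : addi I (x ^+ n.+1) `<=` addi I x.
  apply: addi_min => //; first exact: addi_sub.
  by rewrite exprSr; apply: (ideal_mull _ iJ); apply: addi_mem.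
rewrite mulSnr; apply: (len_le_split (J := addi I x)) => //; last first.
  apply: len_leS hN; first exact: isum_subr.
  apply: isum_sub; [exact: saturation_ideal|exact: saturationS|].
  exact: saturation_sub.
move=> k hk0; apply: IH.
have hk : len_ge (addi I (x ^+ n.+1)) (saturation M (addi I (x ^+ n.+1)) `&` addi I x) k.
  by apply: (len_geS _ (@subset_refl _ _) hk0) => z Kz; split=> //; apply: KJ.
pose phi X := colon X x.
have : len_ge (phi (addi I (x ^+ n.+1)))
              (phi (saturation M (addi I (x ^+ n.+1)) `&` addi I x)) k.
  apply: len_ge_map hk => //.
  - by move=> X; apply: colon_ideal.
  - by move=> X Y XY z; apply: XY.
  (* Below [I + x R], an ideal containing [I] is determined by its colon by [x]. *)
  move=> X Y iX iY IX XY YJ phiYX z Yz; have [_ [a Ia]] := YJ z Yz.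
  have IX' : I `<=` X by apply: subset_trans IX; apply: addi_sub.
  rewrite -(subrK (a * x) z); apply: idealD => //; first exact: IX'.
  apply: phiYX; rewrite /phi /colon /=.
  have -> : a * x = z - (z - a * x) by ring.
  by apply: idealB => //; apply/XY/IX'.
have key z : addi I (x ^+ n.+1) (z * x) -> addi I (x ^+ n) z.
  case=> b Ib; exists b; apply: Ix; rewrite /colon /=.
  by have -> : (z - b * x ^+ n) * x = z * x - b * x ^+ n.+1 by rewrite exprS; ring.
apply: len_geS.
  move=> z [b Ib]; exists b.
  have -> : z * x - b * x ^+ n.+1 = (z - b * x ^+ n) * x by rewrite exprS; ring.
  exact: ideal_mulr.
move=> z [Sz _] w /Sz [m hm]; exists m; apply: key.
by rewrite -mulrA.
Qed.

(** Each of the [size s] elements, when replaced by its [n]-th power, multiplies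
    the bound by [n]; the last elements are replaced first. *)
Lemma len_le_saturation_regseq M I s N n : is_ideal I -> regseq I s ->
  len_le (addl I s) (saturation M (addl I s)) N ->
  let J := addl I [seq x ^+ n | x <- s] in
  len_le J (saturation M J) (N * n ^ size s).
Proof.
elim: s I => [|x s IH] I iI /=; first by rewrite muln1.
case=> Ix xs hN; have := IH _ (addi_ideal x iI) xs hN.
rewrite /= !addl_addi expnS mulnCA; apply: len_le_saturation_exp.
  exact: addl_ideal.
exact: nzd_past_regseq.
Qed.

(** Multiplication by [r] embeds [R / (I : r)] into [R / I]. *)
Lemma len_ge_colon I K L r n : is_ideal I -> is_ideal K -> colon I r `<=` K ->
  len_ge K L n -> len_ge I [set z | exists2 v, L v & I (z - v * r)] n.
Proof.
move=> iI iK IK; pose phi X : set R := [set z | exists2 v, X v & I (z - v * r)].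
move=> h; have : len_ge (phi K) (phi L) n.
  apply: len_ge_map h => //.
  - move=> X iX; split=> [|y z [v Xv Iy] [w Xw Iz]|a y [v Xv Iy]].
    + by exists 0; rewrite ?mul0r ?subrr; apply: ideal0.
    + exists (v + w); first exact: idealD.
      have -> : y + z - (v + w) * r = (y - v * r) + (z - w * r) by ring.
      exact: idealD.
    + exists (a * v); first exact: ideal_mull.
      by rewrite -mulrA -mulrBr; apply: ideal_mull.
  - by move=> X Y XY z [v /XY Yv Iv]; exists v.
  move=> X Y iX iY KX XY _ YX v Yv.
  have [|w Xw Iw] := YX (v * r); first by exists v => //; rewrite subrr; apply: ideal0.
  rewrite -(subrK w v); apply: idealD => //; apply/KX/IK.
  by rewrite /colon /= mulrBl.
apply: len_geS => // z Iz; exists 0; first exact: ideal0.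
by rewrite mul0r subr0.
Qed.

End Length.

(** * Regular sequences, associated primes and chains of primes in local rings *)

Section Local.
Variables (R : comPzRingType) (M : set R).
Hypotheses (noeth : noetherian R) (locM : local_with M).
Implicit Types (I J P : set R) (s : seq R).

Lemma local_maximal : is_maximal M. Proof. exact/locM. Qed.

Lemma local_ideal : is_ideal M. Proof. by case: local_maximal. Qed.

Lemma local_proper : ~ M 1. Proof. by case: local_maximal. Qed.

Lemma proper_sub_local I : is_ideal I -> ~ I 1 -> I `<=` M.
Proof.
move=> iI nI; have [||J [iJ IJ nJ] Jmax] := @noetherian_max _ noeth
  [set J | [/\ is_ideal J, I `<=` J & ~ J 1]]; first by move=> J [].
  by exists I; split.
rewrite -((locM J).1 _) //; split=> // K iK JK.
have [K1|nK] := pselect (K 1); first by right; apply: ideal_full.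
by left; apply: Jmax => //; split=> //; apply: subset_trans JK.
Qed.

Lemma local_unit a : ~ M a -> exists b, b * a = 1.
Proof.
move=> na; apply: contrapT => h; apply: na.
have iA := addi_ideal a (ideal_zero R).
apply: (proper_sub_local iA); last exact/addi_mem/ideal_zero.
by case=> b /eqP; rewrite subr_eq0 => /eqP e; apply: h; exists b.
Qed.

Lemma local_unit_mod a : ~ M a -> exists b, M (1 - b * a).
Proof.
by move=> /local_unit [b e]; exists b; rewrite e subrr; apply: ideal0 local_ideal.
Qed.

Lemma local_prime : is_prime M.
Proof.
split; [exact: local_ideal|exact: local_proper|move=> x y Mxy].
have [|nx] := pselect (M x); first by left.
have [b bx] := local_unit nx; right.
by rewrite -[y]mul1r -bx -mulrA; apply: ideal_mull Mxy; apply: local_ideal.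
Qed.

Lemma prime_sub_local P : is_prime P -> P `<=` M.
Proof. by case=> iP nP _; apply: proper_sub_local. Qed.

Lemma regseq_rcons I s x : regseq I (rcons s x) <-> regseq I s /\ nzd (addl I s) x.
Proof.
elim: s I => [|y s IH] I /=; first by split=> [[]|[]].
by split=> [[Iy /IH [? ?]]|[[Iy ?] ?]]; split=> //; apply/IH.
Qed.

Lemma regseq_nthP I s :
  regseq I s <-> forall i, (i < size s)%N -> nzd (addl I (take i s)) s`_i.
Proof.
elim: s I => [|x s IH] I //=; split=> [[Ix /IH h] [|i] //|h]; first exact: h.
by split; [apply: (h 0%N)|apply/IH => i; apply: (h i.+1)].
Qed.

Lemma regular_seqP s : {in s, forall x, M x} ->
  regular_seq s <-> regseq [set 0] s.
Proof.
move=> sM; split=> [[_ h]|/regseq_nthP h].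
  apply/regseq_nthP => i lt z; rewrite /colon /= mulrC -ideal_gen_addl.
  exact: h.
split=> [e|i lt x]; last by rewrite ideal_gen_addl mulrC; apply: h.
apply: local_proper; suff: ideal_gen [set` s] `<=` M by apply; rewrite e.
by apply: ideal_gen_min; [apply: local_ideal|move=> x; apply: sM].
Qed.

(** Each step down avoids the multiplicative set generated by [x] and the
    complement of the prime already found; regularity of [x] keeps that set
    disjoint from [I]. *)
Lemma regseq_prime_chain I s : is_ideal I -> {in s, forall x, M x} ->
  I `<=` M -> regseq I s -> exists c, prime_chain (size s) c /\ I `<=` c 0%N.
Proof.
elim: s I => [|x s IH] I iI sM IM /=.
  by move=> _; exists (fun=> M); split=> //; split=> // i _; apply: local_prime.
have Mx : M x by apply: sM; rewrite mem_head.
case=> Ix xs; have sM' : {in s, forall y, M y}.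
  by move=> y ys; apply: sM; rewrite inE ys orbT.
have [c [[cP cS] xc]] := IH _ (addi_ideal x iI) sM' (addi_min local_ideal IM Mx) xs.
have [ic nc pc] := cP 0%N isT.
have [||z Iz [t [n [nt e]]]|P [Pp IP PS]] := @prime_avoiding _ noeth I
  [set z | exists t n, ~ c 0%N t /\ z = t * x ^+ n] iI.
- by exists 1, 0%N; rewrite mulr1.
- move=> _ _ [t [m [nt ->]]] [u [n [nu ->]]]; exists (t * u), (m + n)%N.
  by split; [move=> /pc []|rewrite exprD; ring].
- apply/nt/xc/addi_sub; apply: (nzd_exp (n := n) Ix).
  by rewrite /colon /= -e.
(* The new prime is put in front of the chain, so the indices shift by one. *)
exists (fun i => if i is i'.+1 then c i' else P); split=> //; split=> [[|i] // |[|i]] lt.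
- exact: cP.
- split=> [z Pz|cP'].
    by apply: contrapT => nz; apply: (PS z) => //; exists z, 0%N; rewrite mulr1.
  apply: (PS x); last by exists 1, 1%N; rewrite mul1r.
  by apply/cP'/xc/addi_mem.
- exact: cS.
Qed.

(** Extending a regular sequence strictly enlarges the ideal it generates. *)
Lemma regseq_maximal : exists s, [/\ {in s, forall x, M x}, regseq [set 0] s
  & forall x, M x -> ~ nzd (addl [set 0] s) x].
Proof.
have [||_ [s [sM rs ->]] smax] := @noetherian_max _ noeth [set J | exists s,
  [/\ {in s, forall x, M x}, regseq [set 0] s & J = addl [set 0] s]].
- by move=> _ [s [_ _ ->]]; apply/addl_ideal/ideal_zero.
- by exists [set 0], [::].
exists s; split=> // x Mx rx.
have i0 := addl_ideal s (ideal_zero R).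
have xs : addl [set 0] s x.
  rewrite -(smax (addi (addl [set 0] s) x)); [exact: addi_mem| |exact: addi_sub].
  exists (rcons s x); split; last by rewrite addl_rcons.
    by move=> y; rewrite mem_rcons inE => /orP [/eqP ->|/sM].
  by apply/regseq_rcons.
have : addl [set 0] s 1 by apply: rx; rewrite /colon /= mul1r.
move=> /(addl_min local_ideal _ sM) h; apply/local_proper/h.
by move=> y /= ->; apply: ideal0 local_ideal.
Qed.

(** By induction there are [w_i] in [J] that avoid all the primes except
    possibly [P_i]. If every [w_i] lies in [P_i] and there are at least two
    primes, then [w_0 + w_1 .. w_n] avoids all of them. *)
Lemma prime_avoidance J n (P : nat -> set R) : is_ideal J ->
  (forall i, (i < n)%N -> is_prime (P i)) ->
  (forall i, (i < n)%N -> ~ J `<=` P i) ->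
  exists2 w, J w & forall i, (i < n)%N -> ~ P i w.
Proof.
move=> iJ; elim: n P => [|n IH] P pP nP; first by exists 0 => //; apply: ideal0.
apply: contrapT => none.
have pick i : exists w, (i < n.+1)%N ->
    [/\ J w, P i w & forall j, (j < n.+1)%N -> j != i -> ~ P j w].
  have [lt|_] := boolP (i < n.+1)%N; last by exists 0.
  have bl j : (j < n)%N -> (bump i j < n.+1)%N.
    by move=> jn; rewrite /bump; case: (i <= j)%N; rewrite ?add1n ?add0n ?ltnS // ltnW.
  have [j /bl /pP //|j /bl /nP //|w Jw wP] := IH (P \o bump i).
  have nw j : (j < n.+1)%N -> j != i -> ~ P j w.
    move=> jn ji; have e : bump i (unbump i j) = j by rewrite unbumpKcond (negbTE ji).
    rewrite -e; apply: wP; move: jn lt; rewrite /unbump !ltnS.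
    case: (ltngtP j i) ji => //= ij _ jn.
      by rewrite subn0; apply: leq_trans ij.
    by rewrite subn1; case: (j) ij jn.
  exists w => _; split=> //; apply: contrapT => nPi; apply: none; exists w => // j jn.
  by have [->|] := eqVneq j i => //; apply: nw.
have [w wP] := choice pick.
have prodP (Q : set R) m : is_prime Q -> Q (\prod_(1 <= i < m) w i) ->
    exists2 i, (0 < i < m)%N & Q (w i).
  move=> [iQ nQ pQ]; elim: m => [|[|m] IHm]; first by rewrite big_geq.
    by rewrite big_geq.
  rewrite big_nat_recr //= => /pQ [/IHm [i /andP [i0 im]]|Qm].
    by exists i => //; rewrite i0 ltnW.
  by exists m.+1 => //=.
have [Jw0 P0 _] := wP 0%N isT.
case: n => [|n] in IH pP nP none pick wP prodP *.
  apply: (nP 0%N isT) => v Jv; apply: contrapT => nv; apply: none.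
  by exists v => // -[].
apply: none; exists (w 0%N + \prod_(1 <= i < n.+2) w i).
  apply: (idealD iJ) => //; rewrite big_nat_recr //=.
  by apply: (ideal_mull _ iJ); case: (wP n.+1 (ltnSn _)).
move=> [|i] lt Pi.
  have [i0 _ _] := pP 0%N isT.
  have : P 0%N (\prod_(1 <= i < n.+2) w i).
    by have := idealB i0 Pi P0; rewrite addrAC subrr add0r.
  move=> /(prodP _ _ (pP 0%N isT)) [j /andP [j0 jn] Pj].
  by have [_ _ h] := wP j jn; apply: (h 0%N) Pj; rewrite // eq_sym -lt0n.
have [iP _ _] := pP i.+1 lt; have [_ Pw _] := wP i.+1 lt.
have Q : P i.+1 (\prod_(1 <= j < n.+2) w j).
  rewrite (bigD1_seq i.+1) ?iota_uniq ?mem_index_iota //=.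
  exact: ideal_mulr.
have := idealB iP Pi Q; rewrite addrK => P0i.
by have [_ _ h] := wP 0%N isT; apply: (h i.+1) P0i.
Qed.

(** Enlarge [J], starting from [I], by adding elements [g] with [(J : g)]
    maximal and hence prime. A zerodivisor modulo [I] that kills a new element
    of [J + g R] either kills an element of [J] as well or lies in [(J : g)],
    which is then an annihilator modulo [I] itself. *)
Lemma associated_primes I : is_ideal I -> exists n (P : nat -> set R),
  (forall i, (i < n)%N -> is_prime (P i) /\ exists r, P i = colon I r) /\
  forall z r, ~ I r -> I (z * r) -> exists2 i, (i < n)%N & P i z.
Proof.
move=> iI.
have [||J [iJ IJ [n [P [Pass PJ]]]] Jmax] := @noetherian_max _ noeth
  [set J | [/\ is_ideal J, I `<=` J & exists n (P : nat -> set R),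
    (forall i, (i < n)%N -> is_prime (P i) /\ exists r, P i = colon I r) /\
    forall z r, J r -> ~ I r -> I (z * r) -> exists2 i, (i < n)%N & P i z]].
- by move=> J [].
- by exists I; split=> //; exists 0%N, (fun=> I); split.
have [J1|nJ1] := pselect (J 1).
  by exists n, P; split=> // z r; apply: PJ; rewrite (ideal_full iJ J1).
have [||C [g ng Cg] Cmax] := @noetherian_max _ noeth
  [set C | exists2 g, ~ J g & C = colon J g].
- by move=> _ [g _ ->]; apply: colon_ideal.
- by exists (colon J 1), 1.
have primeC : is_prime C.
  rewrite Cg; split; [exact: colon_ideal|by rewrite /colon /= mul1r|].
  move=> x y; rewrite /colon /= => Jxy.
  have [|ny] := pselect (J (y * g)); [by right|left].
  have E : colon J (y * g) = C.
    apply: Cmax; first by exists (y * g).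
    by rewrite Cg => z Jz; rewrite /colon /= mulrCA; apply: ideal_mull.
  suff : C x by rewrite Cg.
  by rewrite -E /colon /= mulrA.
have CA a : ~ C a -> colon J (a * g) = C.
  move=> nCa; apply/seteqP; split=> z.
    move=> Jzag; have : C (z * a) by rewrite Cg /colon /= -mulrA.
    by case: primeC => _ _ h /h [].
  by rewrite Cg /colon /= mulrCA; apply: ideal_mull.
(* The dichotomy: [z] is in a prime of the list, or the new prime is an
   annihilator modulo [I] and contains [z]. *)
have split_new z r : addi J g r -> ~ I r -> I (z * r) ->
    (exists2 i, (i < n)%N & P i z) \/ C = colon I r /\ C z.
  move=> [a Ja] nIr Izr.
  have [[b [Jb nIb]]|nb] := pselect (exists b, J (b * r) /\ ~ I (b * r)).
    by left; apply: PJ nIb _ => //; rewrite mulrCA; apply: ideal_mull.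
  have JI b : J (b * r) -> I (b * r).
    by move=> Jb; apply: contrapT => nIb; apply: nb; exists b.
  have nCa : ~ C a.
    rewrite Cg => Jag; apply: nIr; rewrite -[r]mul1r; apply: JI.
    by rewrite mul1r -(subrK (a * g) r); apply: idealD.
  have E : C = colon I r.
    rewrite -(CA a nCa); apply/seteqP; split=> y; rewrite /colon /= => h.
      apply: JI; have -> : y * r = y * (r - a * g) + y * (a * g) by ring.
      by apply: idealD => //; apply: ideal_mull.
    have -> : y * (a * g) = y * r - y * (r - a * g) by ring.
    by apply: idealB => //; [apply: IJ|apply: ideal_mull].
  by right; split=> //; rewrite E.
suff : J g by [].
rewrite -(Jmax (addi J g)); [exact: addi_mem| |exact: addi_sub].
split; [exact: addi_ideal|exact: subset_trans IJ (@addi_sub _ _ _)|].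
have [[r0 Cr0]|nass] := pselect (exists r, C = colon I r); last first.
  exists n, P; split=> // z r Jr nIr Izr.
  by case: (split_new z r Jr nIr Izr) => // -[E _]; case: nass; exists r.
exists n.+1, (fun i => if (i < n)%N then P i else C); split.
  by move=> i _; case: ifP => [/Pass //|_]; split=> //; exists r0.
move=> z r Jr nIr Izr; case: (split_new z r Jr nIr Izr) => [[i lt Pi]|[_ Cz]].
  by exists i; rewrite ?lt // ltnW.
by exists n; rewrite ?ltnn.
Qed.

(** If [M] lies in none of the finitely many associated primes of [I], prime
    avoidance gives a nonzerodivisor in [M]; otherwise [M r] is in [I] for some
    [r] outside [I]. *)
Lemma depth0_socle I : is_ideal I -> (forall x, M x -> ~ nzd I x) ->
  exists2 r, ~ I r & forall w, M w -> I (w * r).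
Proof.
move=> iI zd; apply: contrapT => nsoc.
have [n [P [Pass PI]]] := associated_primes iI.
have [i lt|i lt MP|w Mw nP] := prime_avoidance (n := n) (P := P) local_ideal.
- by case: (Pass i lt).
- have [[_ nP _] [r E]] := Pass i lt; apply: nsoc; exists r.
    by move=> Ir; apply: nP; rewrite E; apply: ideal_mull.
  by move=> w /MP; rewrite E.
apply: (zd w Mw) => z Iz; apply: contrapT => nz.
by have [i lt] := PI w z nz (eq_ind _ I Iz _ (mulrC z w)); apply: nP.
Qed.

End Local.

(** * Chains of primes and the growth of R / M^n *)

Section Growth.
Variables (R : comNzRingType) (M : set R).
Hypotheses (noeth : noetherian R) (locM : local_with M).

Let iM : is_ideal M := local_ideal locM.

(** If [x] is in all powers of [M], the Artin-Rees bound for multiples of [x]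
    puts [1] into [M]. *)
Lemma krull_intersection (x : R) :
  nzd [set 0] x -> ~ forall n, ideal_pow M n x.
Proof.
move=> x0 Mx; have [b hb] := artin_rees noeth iM (ideal_zero R) x0.
have : isum [set 0] (ideal_pow M 1) 1.
  apply: (hb 1%N); exists 0 => //; rewrite mul1r subr0; exact: Mx.
case=> _ -> M1; apply: (local_proper locM).
by rewrite -(subr0 1); apply: (ideal_pow_sub iM (ltn0Sn 0)).
Qed.

(** For [y] in [P_1] but not in [P_0], the exact sequence
    [R/((P_0 + M^n) : y) -> R/(P_0 + M^n) -> R/(P_0 + M^n + y R)] and the
    Artin-Rees constant [b] of [y] modulo [P_0] give the inequality
    [f(n) >= f(n - b) + g(n)] between the lengths [f] and [g] of the quotients of
    [R / P_0] and [R / P_1]; summing raises the order of growth by one. *)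
Lemma prime_chain_len_ge d (c : nat -> set R) : prime_chain d c -> exists a,
  forall n, (0 < n)%N -> len_ge (isum (c 0%N) (ideal_pow M (a * n))) setT (n ^ d).
Proof.
elim: d c => [|d IH] c [cP cS].
  exists 1%N => n n0; rewrite mul1n; exists setT; split=> //; split=> // h.
  apply: (local_proper locM); have := h 1 I.
  apply: (isum_sub iM); first exact: prime_sub_local (cP 0%N isT).
  exact: ideal_pow_sub.
(* The tail of the chain starts at [P_1]. *)
have [a ha] : exists a, forall n, (0 < n)%N ->
    len_ge (isum (c 1%N) (ideal_pow M (a * n))) setT (n ^ d).
  by apply: (IH (fun i => c i.+1)); split=> i lt; [apply: cP|apply: cS].
have [c01 nc01] := cS 0%N isT.
have [y y1 ny] : exists2 y, c 1%N y & ~ c 0%N y.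
  apply: contrapT => h; apply: nc01 => y cy; apply: contrapT => ny.
  by apply: h; exists y.
have [i0 _ p0] := cP 0%N isT; have [i1 _ _] := cP 1%N isT.
have [b hb] : exists b, forall n, colon (isum (c 0%N) (ideal_pow M (n + b))) y
    `<=` isum (c 0%N) (ideal_pow M n).
  by apply: artin_rees => // z /p0 [].
exists (a + b)%N => n n0; rewrite mulnDl.
have iX m : is_ideal (isum (c 0%N) (ideal_pow M m)).
  exact: isum_ideal i0 (ideal_pow_ideal _ _).
(* With [j = n] this is the bound for [M ^ ((a + b) * n)]. *)
suff h j : len_ge (isum (c 0%N) (ideal_pow M (a * n + b * j))) setT (j * n ^ d).
  by rewrite expnS; apply: h.
elim: j => [|j IHj] //; rewrite mulnS addnCA addnC mulSnr.
apply: len_ge_cat (len_ge_colon (iX _) (iX _) (hb _) IHj) _.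
apply: len_geS (ha n n0) => // z [v _ [u cu Mw]].
exists (v * y + u); first by apply: idealD => //; [apply: ideal_mull|apply: c01].
rewrite opprD addrA; apply: ideal_powW Mw.
by rewrite -addnA leq_addr.
Qed.

Lemma prime_chain_le_growth (p k e1 N d : nat) (c : nat -> set R) : (1 < p)%N ->
  (forall e, len_le (ideal_pow M (p ^ e)) setT (N * (p ^ (e + e1)) ^ k)) ->
  prime_chain d c -> (d <= k)%N.
Proof.
move=> p1 hN pc; have [i0 _ _] := pc.1 0%N isT.
have [a ha] := prime_chain_len_ge pc; rewrite leqNgt; apply/negP => kd.
have p0 : (0 < p)%N by apply: ltnW.
(* [a * n <= p ^ (a + B)], so the two bounds give [n ^ d <= B * n ^ k] for this
   [n], which exceeds [B]. *)
pose B := (N * (p ^ (a + e1)) ^ k)%N; pose n := (p ^ B)%N.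
have n0 : (0 < n)%N by rewrite expn_gt0 p0.
have : (n ^ d <= B * n ^ k)%N.
  have -> : (B * n ^ k = N * (p ^ (a + B + e1)) ^ k)%N.
    by rewrite /B /n -mulnA -expnMn -expnD addnAC.
  apply: hN; apply: len_geS (ha n n0) => //.
  move=> z Mz; apply: isum_subr => //.
  apply: ideal_powW Mz; rewrite expnD leq_mul2r; apply/orP; right.
  exact/ltnW/ltn_expl.
apply/negP; rewrite -ltnNge.
apply: (@leq_trans (n ^ k.+1)); last exact: leq_pexp2l.
by rewrite expnS ltn_mul2r expn_gt0 n0 /= ltn_expl.
Qed.

End Growth.

(** * Frobenius powers in F-pure rings *)

Section IdealQuotient.
Variables (R : comPzRingType) (I : set R) (iI : is_ideal I).

Let eqI x y := I (x - y).
Let by_eq x y : x = y -> eqI x y.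
Proof. by move=> ->; rewrite /eqI subrr; apply: ideal0. Qed.
Let eqI_sym x y : eqI x y -> eqI y x.
Proof. by rewrite /eqI -[y - x]opprB; apply: idealN. Qed.
Let eqI_trans x y z : eqI x y -> eqI y z -> eqI x z.
Proof. by rewrite /eqI -[x - z](subrKA y); apply: idealD. Qed.
Let eqI_opp x y : eqI x y -> eqI (- x) (- y).
Proof. by rewrite /eqI -opprD; apply: idealN. Qed.
Let eqI_add x y z : eqI x y -> eqI (x + z) (y + z).
Proof. by rewrite /eqI opprD addrACA subrr addr0. Qed.
Let eqI_mul x y z : eqI x y -> eqI (x * z) (y * z).
Proof. by rewrite /eqI -mulrBl; apply: ideal_mulr. Qed.

(** [R / I], needed as a test module for purity, with [I] an arbitrary
    predicate and possibly the whole ring. *)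
Definition quotient_setoid : setoid_ring :=
  @SetoidRing R eqI 0 1 -%R +%R *%R (fun x => by_eq (erefl x)) eqI_sym eqI_trans
    eqI_opp eqI_add eqI_mul
    (fun x y z => by_eq (addrA x y z)) (fun x y => by_eq (addrC x y))
    (fun x => by_eq (add0r x)) (fun x => by_eq (addNr x))
    (fun x y z => by_eq (mulrA x y z)) (fun x y => by_eq (mulrC x y))
    (fun x => by_eq (mul1r x)) (fun x y z => by_eq (mulrDl x y z)).

Definition quotient_ring : comPzRingType := sr_quot quotient_setoid.

Definition quotient_map : R -> quotient_ring := @sr_class quotient_setoid \o id.

Fact quotient_map_zmod : zmod_morphism quotient_map.
Proof. by apply: (@sr_class_zmod quotient_setoid R id) => x y; apply: by_eq. Qed.
Fact quotient_map_monoid : monoid_morphism quotient_map.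
Proof. by apply: (@sr_class_monoid quotient_setoid R id) => [|x y]; apply: by_eq. Qed.

HB.instance Definition _ := GRing.isZmodMorphism.Build R quotient_ring
  quotient_map quotient_map_zmod.
HB.instance Definition _ := GRing.isMonoidMorphism.Build R quotient_ring
  quotient_map quotient_map_monoid.

Lemma quotient_mapP x y : quotient_map x = quotient_map y <-> I (x - y).
Proof. exact: (@sr_classP quotient_setoid). Qed.

End IdealQuotient.

Section FPurity.
Variables (R : comNzRingType) (p : nat) (charRp : p \in [pchar R]).
Implicit Types (s : seq R) (r : R).

Local Notation F := (frobenius charRp).

Lemma frobeniusE r : F r = r ^+ p. Proof. by []. Qed.

Lemma iter_frobenius e r : iter e F r = r ^+ (p ^ e).
Proof.
by elim: e => [|e IH]; rewrite ?expr1 // iterS IH frobeniusE -exprM -expnSr.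
Qed.

Lemma expr_pchar_powD e r r' : (r + r') ^+ (p ^ e) = r ^+ (p ^ e) + r' ^+ (p ^ e).
Proof. by rewrite -!iter_frobenius; elim: e => // e IH; rewrite !iterS IH rmorphD. Qed.

Lemma expr_pchar_pow_sum e n (f : 'I_n -> R) :
  (\sum_(i < n) f i) ^+ (p ^ e) = \sum_(i < n) f i ^+ (p ^ e).
Proof.
have p0 : (0 < p ^ e)%N by rewrite expn_gt0 prime_gt0 // (pcharf_prime charRp).
elim: n f => [|n IH] f; first by rewrite !big_ord0 expr0n gtn_eqF.
by rewrite !big_ord_recr /= expr_pchar_powD IH.
Qed.

Hypothesis Fpure : F_pure charRp.

(** If [r ^+ p] is in the ideal generated by the [x ^+ p], then
    [r (x) 1 = 1 (x) r ^+ p = 0] in [R/(s) (x) F_*R], so purity makes the class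
    of [r] in [R/(s)] vanish. *)
Lemma F_pure_contract1 s r :
  ideal_gen [set` [seq x ^+ p | x <- s]] (r ^+ p) -> ideal_gen [set` s] r.
Proof.
move=> rp; set I := ideal_gen [set` s].
have iI : is_ideal I := ideal_gen_ideal _.
pose Q : lmodType R := restr_scalars (quotient_map iI).
pose N : lmodType R := restr_scalars F.
pose q (x : R) : Q := quotient_map iI x.
have qZ x : q x = x *: q 1.
  by rewrite -[x in LHS]mulr1 /q rmorphM.
(* All multiples are included to make [T] an ideal of [R], since [F_*R] is an
   [R]-module only through the Frobenius. *)
pose T : set R := [set n | forall a, tensor_eq [:: (q 1, (a * n : N))] [::]].
have iT : is_ideal T.
  split=> [a|x y Tx Ty a|b x Tx a].
  - have -> : (a * 0 : N) = (0 : R) *: (1 : N).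
      by rewrite mulr0 scale0r.
    apply: tensor_trans (tensor_sym (tensor_scale _ _ _)) _.
    by rewrite scale0r; apply: tensor_nil.
  - rewrite mulrDr; apply: tensor_trans (tensor_addr (q 1) (a * x : N) (a * y : N)) _.
    exact: (tensor_cat (Tx a) (Ty a)).
  - by rewrite mulrA; apply: Tx.
have Tr : T (r ^+ p).
  apply: (ideal_gen_min iT _ rp) => _ /= /mapP [x xs ->] a.
  have -> : (a * x ^+ p : N) = x *: (a : N) by rewrite mulrC.
  apply: tensor_trans (tensor_sym (tensor_scale _ _ _)) _.
  rewrite -qZ; have -> : q x = 0.
    rewrite /q -(rmorph0 (quotient_map iI)).
    by apply/quotient_mapP; rewrite subr0; apply: ideal_gen_sub.
  exact: tensor_nil.
have : q r = q 0.
  apply: Fpure; apply/cclassP; rewrite qZ.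
  apply: tensor_trans (tensor_scale _ _ _) _.
  have -> : r *: (1 : N) = (1 * r ^+ p : N) by rewrite mulrC.
  apply: tensor_trans (Tr 1) _; apply: tensor_sym.
  by rewrite /q rmorph0; apply: tensor_nil.
by move/quotient_mapP; rewrite subr0.
Qed.

Lemma F_pure_contract e s r :
  ideal_gen [set` [seq x ^+ (p ^ e) | x <- s]] (r ^+ (p ^ e)) ->
  ideal_gen [set` s] r.
Proof.
elim: e s r => [|e IH] s r.
  by rewrite expr1 (eq_map (g := id)) ?map_id // => x; rewrite expr1.
rewrite expnSr exprM (eq_map (g := (fun x => x ^+ p) \o (fun x => x ^+ (p ^ e)))).
  by rewrite map_comp => /F_pure_contract1 /IH.
by move=> x; rewrite /= exprM.
Qed.

End FPurity.

(** * Colon ideals in coherent rings *)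

Section CoherentColon.
Variable A : comPzRingType.

(** The elements of the colon ideal are the first coordinates of the
    relations between [r, s_1 .. s_n]. Coherence provides finitely many
    generators for the relations of some other system of generators [a]; with
    [b = U a] and [a = V b], the relations of [b] are generated by the rows of
    [1 - U V] and [K V]. *)
Lemma coherent_colon (s : seq A) (r : A) : coherent A -> exists t : seq A,
  colon (ideal_gen [set` s]) r = ideal_gen [set` t].
Proof.
move=> coh; pose n := size s; pose I := ideal_gen [set` r :: s].
have iI : is_ideal I := ideal_gen_ideal _.
have [|m [l [a [K [aI aK]]]]] := coh I iI; first by exists (r :: s).
pose b : 'cV[A]_n.+1 := \col_i (r :: s)`_i.
have bI x : I x -> exists c : 'rV[A]_n.+1, c *m b = x%:M.
  move=> /ideal_gen_sumP [c ->]; exists (\row_i c i); apply/rowP => i.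
  rewrite !mxE ord1 eqxx mulr1n; apply: eq_bigr => j _.
  by rewrite !mxE.
have aIi i : I (a i 0).
  apply/aI; exists (delta_mx 0 i); rewrite -rowE; apply/rowP => j.
  by rewrite !mxE !ord1.
have bIi i : I (b i 0).
  by rewrite mxE; apply: ideal_gen_sub; apply: mem_nth.
have [U0 UE] := choice (fun i => (aI _).1 (bIi i)).
have [V0 VE] := choice (fun i => bI _ (aIi i)).
pose U := \matrix_i U0 i; pose V := \matrix_i V0 i.
have bE : b = U *m a.
  apply/colP => i; transitivity ((U0 i *m a) 0 0).
    by rewrite UE [RHS]mxE eqxx mulr1n.
  by rewrite [LHS]mxE [RHS]mxE; apply: eq_bigr => j _; rewrite [in RHS]mxE.
have aE : a = V *m b.
  apply/colP => i; transitivity ((V0 i *m b) 0 0).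
    by rewrite VE [RHS]mxE eqxx mulr1n.
  by rewrite [LHS]mxE [RHS]mxE; apply: eq_bigr => j _; rewrite [V i j]mxE.
pose K1 := 1%:M - U *m V; pose K2 := K *m V.
have K1b : K1 *m b = 0 by rewrite mulmxBl mul1mx -mulmxA -aE -bE subrr.
have K2b : K2 *m b = 0.
  rewrite -mulmxA -aE; apply/row_matrixP => i; rewrite row0 row_mul.
  by apply/aK; exists (delta_mx 0 i); rewrite -rowE.
have relE (c : 'rV[A]_n.+1) : c *m b = 0 -> exists u, c = c *m K1 + u *m K2.
  rewrite {1}bE mulmxA => /aK [u uE]; exists u.
  by rewrite mulmxBr mulmx1 !mulmxA uE subrK.
have colonE (c : 'rV[A]_n.+1) : c *m b = 0 -> colon (ideal_gen [set` s]) r (c 0 0).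
  move=> /rowP /(_ 0); rewrite !mxE big_ord_recl !mxE /= => /eqP.
  rewrite addr_eq0 => /eqP e; rewrite /colon /= e.
  apply: (idealN (ideal_gen_ideal _)).
  apply/ideal_gen_sumP; exists (fun i => c 0 (inord i.+1)).
  apply: eq_bigr => i _; rewrite mxE /=; congr (c 0 _ * _).
  by apply/val_inj; rewrite /= inordK // ltnS.
exists ([seq K1 i 0 | i : 'I_n.+1] ++ [seq K2 i 0 | i : 'I_l]).
set t := _ ++ _; have iT := ideal_gen_ideal [set` t].
have iS := ideal_gen_ideal [set` s].
apply/seteqP; split=> [z|]; last first.
  apply: ideal_gen_min; first exact: colon_ideal.
  move=> z /=; rewrite mem_cat => /orP [] /mapP [i _ ->].
    have := colonE (row i K1); rewrite mxE; apply.
    by rewrite -row_mul K1b row0.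
  have := colonE (row i K2); rewrite mxE; apply.
  by rewrite -row_mul K2b row0.
move=> /ideal_gen_sumP [d zE].
pose c : 'rV[A]_n.+1 := \row_i (if i == 0 :> nat then z else - d i.-1).
have cb : c *m b = 0.
  apply/rowP => i; rewrite !mxE big_ord_recl !mxE /= ord1 zE.
  rewrite -big_split big1 //= => j _; rewrite !mxE /=.
  by rewrite mulNr subrr.
have [u cE] := relE c cb.
have -> : z = c 0 0 by rewrite mxE.
rewrite cE mxE; apply: (idealD iT); rewrite mxE; apply: (ideal_sum _ iT) => i _;
  apply: (ideal_mull _ iT); apply: ideal_gen_sub; rewrite /= mem_cat.
  by apply/orP; left; apply/mapP; exists i; rewrite ?mem_enum.
by apply/orP; right; apply/mapP; exists i; rewrite ?mem_enum.
Qed.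

End CoherentColon.

(** * The perfection as a union of rings of p-power roots *)

Section Perfection.
Variables (R : idomainType) (p : nat) (charRp : p \in [pchar R]).
Implicit Types (s : seq R) (r : R).

Local Notation A := (perfection charRp).
Local Notation S := (iter_colim_setoid (frobenius charRp)).

(** The [p ^ e]-th root of [r]. *)
Definition pth_root e r : A := @sr_class S (e, r).

Lemma pth_root_eq e f r r' :
  pth_root e r = pth_root f r' <-> exists k, r ^+ (p ^ (f + k)) = r' ^+ (p ^ (e + k)).
Proof.
split=> [/(@sr_classP S) [k /=]|[k e_k]].
  by rewrite !iter_frobenius; exists k.
by apply/(@sr_classP S); exists k; rewrite /= !iter_frobenius.
Qed.

Lemma pth_root_surj (a : A) : exists e r, a = pth_root e r.
Proof. by have [[e r] ->] := @sr_quotP S a; exists e, r. Qed.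

Lemma pth_root_lift e j r : pth_root e r = pth_root (e + j) (r ^+ (p ^ j)).
Proof. by apply/pth_root_eq; exists 0%N; rewrite -exprM -expnD !addn0 addnC. Qed.

Lemma expr_pchar_inj e : injective (fun r : R => r ^+ (p ^ e)).
Proof.
move=> x y /= /eqP; rewrite -subr_eq0 => /eqP h; apply/eqP; rewrite -subr_eq0.
suff : (x - y) ^+ (p ^ e) == 0 by rewrite expf_eq0 => /andP [].
have := expr_pchar_powD charRp e (x - y) y.
by rewrite subrK => E; apply/eqP; rewrite E addrK in h.
Qed.

Lemma pth_root_inj e : injective (pth_root e).
Proof. by move=> x y /pth_root_eq [k]; apply: expr_pchar_inj. Qed.

Lemma pth_rootD e r r' : pth_root e r + pth_root e r' = pth_root e (r + r').
Proof.
rewrite -[LHS]/(srq_add (pth_root e r) (pth_root e r')) sr_addE /=.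
rewrite /col_add /= !iter_frobenius.
by rewrite -(expr_pchar_powD charRp) -/(pth_root _ _) -pth_root_lift.
Qed.

Lemma pth_rootM e r r' : pth_root e r * pth_root e r' = pth_root e (r * r').
Proof.
rewrite -[LHS]/(srq_mul (pth_root e r) (pth_root e r')) sr_mulE /=.
rewrite /col_mul /= !iter_frobenius.
by rewrite -exprMn -/(pth_root _ _) -pth_root_lift.
Qed.

Lemma pth_root1 e : pth_root e 1 = 1.
Proof. by rewrite -[1 in RHS]/(pth_root 0 1) (pth_root_lift 0 e) expr1n. Qed.

Lemma pth_root0 e : pth_root e 0 = 0.
Proof. by apply: (addrI (pth_root e 0)); rewrite pth_rootD !addr0. Qed.

Lemma pth_root_sum e n (f : 'I_n -> R) :
  \sum_(i < n) pth_root e (f i) = pth_root e (\sum_(i < n) f i).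
Proof.
elim: n f => [|n IH] f; first by rewrite !big_ord0 pth_root0.
by rewrite !big_ord_recr /= IH pth_rootD.
Qed.

Lemma common_pth_root (t : seq A) f :
  exists e g, [/\ (f <= e)%N & t = map (pth_root e) g].
Proof.
elim: t => [|a t [e [g [fe ->]]]]; first by exists f, [::].
have [d [r ->]] := pth_root_surj a.
exists (d + e)%N, (r ^+ (p ^ e) :: [seq x ^+ (p ^ d) | x <- g]); split.
  exact: leq_trans (leq_addl _ _).
rewrite /= -pth_root_lift -map_comp; congr (_ :: _); apply: eq_map => x /=.
by rewrite addnC -pth_root_lift.
Qed.

Hypothesis Fpure : F_pure charRp.

(** Any equation in [A] holds in some [R^(1/p^f)], where raising it to the
    power [p ^ f] turns it into a relation between Frobenius powers in [R]. *)
Lemma pth_root_contract e s r :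
  ideal_gen [set` map (pth_root e) s] (pth_root e r) -> ideal_gen [set` s] r.
Proof.
move=> /ideal_gen_sumP [c]; rewrite size_map => rE.
have [f [g [ef cE]]] := common_pth_root (mkseq c (size s)) e.
have cg (i : 'I_(size s)) : c i = pth_root f g`_i.
  have sg : size g = size s by rewrite -(size_map (pth_root f)) -cE size_mkseq.
  by rewrite -[LHS](nth_mkseq 0 c (ltn_ord i)) cE (nth_map 0) // sg.
have fE : (e + (f - e) = f)%N by rewrite subnKC.
apply: (F_pure_contract (e := f - e) Fpure).
apply/ideal_gen_sumP; exists (fun i => g`_i); rewrite size_map.
apply: (@pth_root_inj f); rewrite -{1}fE -pth_root_lift rE -pth_root_sum.
apply: eq_bigr => i _; rewrite cg (nth_map 0) // (nth_map 0) //.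
by rewrite (pth_root_lift e (f - e)) fE pth_rootM.
Qed.

(** Both conclusions about [R] are drawn from coherence through this bound. The
    colon ideal [(s A : r)] is generated by roots [g_i^(1/p^e1)], with [g_i] in
    [M] since a unit among them would put [r] into [(s)]. The [p^(e+e1)]-th
    power of an element of [R^(1/p^(e+e1))] in this colon ideal lies in
    [(g_i^(p^e))], by contraction from [A]. *)
Lemma coherent_colon_powers (M : set R) s r : noetherian R -> local_with M ->
  coherent A -> ~ ideal_gen [set` s] r -> exists e1, forall e,
  colon (ideal_gen [set` [seq x ^+ (p ^ (e + e1)) | x <- s]]) (r ^+ (p ^ (e + e1)))
    `<=` ideal_pow M (p ^ e).
Proof.
move=> noeth locM coh nr.
have [t tE] := coherent_colon (map (pth_root 0) s) (pth_root 0 r) coh.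
have [e1 [g [_ gE]]] := common_pth_root t 0.
have iS := ideal_gen_ideal [set` map (pth_root 0) s].
have gM x : x \in g -> M x.
  move=> xg; apply: contrapT => /(local_unit noeth locM) [b bx].
  apply: nr; apply: (pth_root_contract (e := 0)).
  suff : colon (ideal_gen [set` map (pth_root 0) s]) (pth_root 0 r) 1.
    by rewrite /colon /= mul1r.
  rewrite tE gE -(pth_root1 e1) -bx -pth_rootM.
  apply: (ideal_mull _ (ideal_gen_ideal _)).
  by apply: ideal_gen_sub; apply: map_f.
exists e1 => e z; rewrite /colon /= => zr.
have : ideal_gen [set` t] (pth_root (e + e1) z).
  rewrite -tE /colon /= (pth_root_lift 0 (e + e1)) pth_rootM.
  move: zr => /ideal_gen_sumP [c ->]; rewrite -pth_root_sum size_map.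
  apply/ideal_gen_sumP; exists (fun i => pth_root (e + e1) (c i)).
  rewrite size_map; apply: eq_bigr => i _.
  by rewrite -pth_rootM !(nth_map 0) // [in RHS](pth_root_lift 0 (e + e1)).
have -> : t = map (pth_root (e + e1)) [seq x ^+ (p ^ e) | x <- g].
  rewrite gE -map_comp; apply: eq_map => x /=.
  by rewrite (pth_root_lift e1 e) addnC.
move/pth_root_contract; apply: ideal_gen_min; first exact: ideal_pow_ideal.
by move=> _ /mapP [x /gM Mx ->]; apply: ideal_pow_exp Mx.
Qed.

End Perfection.

(** * Least common multiples in factorial domains and their perfections *)

Section UFD.
Variable R : idomainType.
Implicit Types (a b c g w x y : R) (s : seq R) (n : nat).

Definition dvd a x := exists u, x = u * a.

Lemma dvd_prod s a : a \in s -> dvd a (\prod_(x <- s) x).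
Proof.
by move=> sa; rewrite (big_rem a sa); exists (\prod_(y <- rem a s) y); rewrite mulrC.
Qed.

(** Euclid's lemma: factor [x], [y] and [x * y / q] and compare. *)
Lemma irreducible_dvdM q x y : ufd R -> irreducible_elt q ->
  dvd q (x * y) -> dvd q x \/ dvd q y.
Proof.
move=> [fact uniq] irq [z e].
have [->|x0] := eqVneq x 0; first by left; exists 0; rewrite mul0r.
have [->|y0] := eqVneq y 0; first by right; exists 0; rewrite mul0r.
have [ux|nx] := boolP (x \is a GRing.unit).
  by right; exists (x^-1 * z); rewrite -mulrA -e mulKr.
have [uy|ny] := boolP (y \is a GRing.unit).
  by left; exists (y^-1 * z); rewrite -mulrA -e mulrCA mulVr ?mulr1.
have [sx irx xE] := fact x x0 nx; have [sy iry yE] := fact y y0 ny.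
have z0 : z != 0.
  by apply: contra_neq (mulf_neq0 x0 y0) => z0; rewrite e z0 mul0r.
have [q0 nq qirr] := irq.
(* If [z] is a unit it is absorbed into [q]. *)
have [h [t [irt tE [v hE]]]] : exists h t,
  [/\ forall a, a \in h :: t -> irreducible_elt a,
    x * y = \prod_(a <- h :: t) a & exists v, h = v * q].
  have [uz|nz] := boolP (z \is a GRing.unit).
    exists (z * q), [::]; split; [|by rewrite big_seq1|by exists z].
    move=> a; rewrite inE => /eqP ->; split; first exact: mulf_neq0.
      by rewrite unitrMr.
    move=> c d qcd; have [|u|u] := qirr (z^-1 * c) d.
    + by rewrite -mulrA -qcd mulKr.
    + by left; move: u; rewrite unitrMr // unitrV.
    + by right.
  have [sz irz zE] := fact z z0 nz; exists q, sz; split; last by exists 1; rewrite mul1r.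
    by move=> a; rewrite inE => /orP [/eqP -> //|/irz].
  by rewrite big_cons -zE e mulrC.
have irs a : a \in sx ++ sy -> irreducible_elt a.
  by rewrite mem_cat => /orP [/irx|/iry].
have [|t' [pt st tt]] := uniq (sx ++ sy) (h :: t) irs irt.
  by rewrite big_cat /= -xE -yE tE.
have ht : h \in t' by rewrite -(perm_mem pt) mem_head.
pose i := index h t'.
have it : (i < size (sx ++ sy))%N by rewrite st index_mem.
have [u _] := tt i it; rewrite nth_index // => iE.
have qi : dvd q (sx ++ sy)`_i by rewrite iE hE; exists (u * v); rewrite mulrA.
have := mem_nth 0 it; rewrite mem_cat; case: qi => k -> /orP [] /dvd_prod.
  by rewrite -xE => -[m ->]; left; exists (m * k); rewrite mulrA.
by rewrite -yE => -[m ->]; right; exists (m * k); rewrite mulrA.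
Qed.

(** A form of coprimality of [x] and [c] that is multiplicative in [x] and
    makes no reference to factorizations. *)
Definition cancels c x := forall w, dvd x (c * w) -> dvd x w.

Lemma cancelsM c x y : x != 0 -> cancels c x -> cancels c y -> cancels c (x * y).
Proof.
move=> x0 cx cy w [u e].
have [|v wE] := cx w; first by exists (u * y); rewrite e -mulrA [y * x]mulrC.
have [|k vE] := cy v.
  by exists u; apply: (mulfI x0); rewrite mulrCA [x * v]mulrC -wE e; ring.
by exists k; rewrite wE vE -mulrA [y * x]mulrC.
Qed.

Lemma cancelsX c x n : x != 0 -> cancels c x -> cancels c (x ^+ n).
Proof.
move=> x0 cx; elim: n => [|n IH]; first by move=> w _; exists w; rewrite mulr1.
by rewrite exprS; apply: cancelsM.
Qed.

Lemma irreducible_cancels q b n : ufd R -> irreducible_elt q -> ~ dvd q b ->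
  cancels (b ^+ n) q.
Proof.
move=> ufdR irq nqb w; elim: n => [|n IH]; first by rewrite mul1r.
by rewrite exprS -mulrA => /(irreducible_dvdM ufdR irq) [/nqb|/IH].
Qed.

(** Divide out the irreducible factors that [a] shares with [b], one at a
    time; the remaining factors of [a] divide no power of the cofactor of [b]. *)
Lemma ufd_split a b : ufd R -> a != 0 -> b != 0 -> exists g a' b',
  [/\ a = g * a', b = g * b', a' != 0 & forall n, cancels (b' ^+ n) a'].
Proof.
move=> ufdR a0 b0; have [ua|na] := boolP (a \is a GRing.unit).
  exists 1, a, b; rewrite !mul1r; split=> // n w _.
  by exists (w * a^-1); rewrite mulrVK.
have [s irs ->] := ufdR.1 a a0 na.
elim: s {a a0 na} b b0 irs => [|q s IH] b b0 irs.
  exists 1, 1, b; rewrite big_nil !mul1r oner_neq0; split=> // n w _.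
  by exists w; rewrite mulr1.
have irq : irreducible_elt q by apply: irs; rewrite mem_head.
have {}irs a : a \in s -> irreducible_elt a.
  by move=> as_; apply: irs; rewrite inE as_ orbT.
have [[b1 bE]|nqb] := pselect (dvd q b).
  have b10 : b1 != 0 by apply: contra_neq b0 => b10; rewrite bE b10 mul0r.
  have [g [a' [b' [aE b1E a'0 cop]]]] := IH b1 b10 irs.
  exists (q * g), a', b'; split=> //; first by rewrite big_cons aE mulrA.
  by rewrite bE b1E mulrC mulrA.
have [g [a' [b' [aE bE a'0 cop]]]] := IH b b0 irs.
have [q0 _ _] := irq.
exists g, (q * a'), b'; split=> //; first by rewrite big_cons aE mulrCA.
  exact: mulf_neq0.
move=> n; apply: cancelsM => //; apply: irreducible_cancels => //.
by move=> [u b'E]; apply: nqb; exists (g * u); rewrite bE b'E mulrA.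
Qed.

(** With [a = g a'] and [b = g b'] as in [ufd_split], the element [g a' b'] is
    a least common multiple, and so are its powers for the powers of [a] and
    [b]. *)
Lemma ufd_lcm a b : ufd R -> exists l, [/\ dvd a l, dvd b l
  & forall n w, (0 < n)%N -> dvd (a ^+ n) w -> dvd (b ^+ n) w -> dvd (l ^+ n) w].
Proof.
move=> ufdR; have [->|a0] := eqVneq a 0.
  by exists 0; split=> //; [exists 0; rewrite mul0r..].
have [->|b0] := eqVneq b 0.
  by exists 0; split=> //; [exists 0; rewrite mul0r..].
have [g [a' [b' [aE bE a'0 cop]]]] := ufd_split ufdR a0 b0.
have g0 : g != 0 by apply: contra_neq a0 => g0; rewrite aE g0 mul0r.
exists (g * a' * b'); split.
- by exists b'; rewrite aE; ring.
- by exists a'; rewrite bE; ring.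
move=> n w _ [u wE] [v wE'].
have [|k vE] := @cancelsX (b' ^+ n) a' n a'0 (cop n) v.
  exists u; apply: (mulfI (expf_neq0 n g0)).
  by rewrite mulrA -exprMn -bE mulrC -wE' wE aE exprMn; ring.
by exists k; rewrite wE' vE bE !exprMn; ring.
Qed.

End UFD.

Section GCD.
Variables (R : idomainType) (p : nat) (charRp : p \in [pchar R]).
Local Notation A := (perfection charRp).

Lemma common_pth_root2 (x y : A) f : exists e a b,
  [/\ (f <= e)%N, x = pth_root charRp e a & y = pth_root charRp e b].
Proof.
have [e [g [fe gE]]] := common_pth_root [:: x; y] f.
case: g gE => [|a [|b [|]]] //= [-> ->].
by exists e, a, b.
Qed.

Lemma perfection_domain : is_domain A.
Proof.
split=> [|x y].
  rewrite -(pth_root1 charRp 0) -(pth_root0 charRp 0) => /pth_root_inj /eqP.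
  by rewrite oner_eq0.
have [e [a [b [_ -> ->]]]] := common_pth_root2 x y 0.
rewrite pth_rootM -(pth_root0 charRp e) => /pth_root_inj /eqP.
by rewrite mulf_eq0 => /orP [/eqP ->|/eqP ->]; [left|right].
Qed.

(** Two elements of [A] lie in a common copy [R^(1/p^e)], and their least
    common multiple there remains one in the larger copies, where the elements
    are replaced by powers. *)
Lemma perfection_gcd : ufd R -> gcd_domain A.
Proof.
move=> ufdR; split=> [|x y]; first exact: perfection_domain.
have [e [a [b [_ -> ->]]]] := common_pth_root2 x y 0.
have [l [[u al] [v bl] lmin]] := ufd_lcm a b ufdR.
exists (pth_root charRp e l); apply/seteqP; split=> z.
  move=> [/ideal_gen1P [c zc] /ideal_gen1P [d zd]].
  have [f [c' [d' [ef cE dE]]]] := common_pth_root2 c d e.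
  have fE : (e + (f - e) = f)%N by rewrite subnKC.
  have levelE r : pth_root charRp e r = pth_root charRp f (r ^+ (p ^ (f - e))).
    by rewrite [LHS](pth_root_lift _ e (f - e)) fE.
  have zE : z = pth_root charRp f (c' * a ^+ (p ^ (f - e))).
    by rewrite zc cE levelE pth_rootM.
  have zE' : z = pth_root charRp f (d' * b ^+ (p ^ (f - e))).
    by rewrite zd dE levelE pth_rootM.
  have [|||k kE] := lmin (p ^ (f - e))%N (c' * a ^+ (p ^ (f - e))).
  - by rewrite expn_gt0 prime_gt0 // (pcharf_prime charRp).
  - by exists c'.
  - by exists d'; apply: (@pth_root_inj _ _ charRp f); rewrite -zE -zE'.
  by apply/ideal_gen1P; exists (pth_root charRp f k); rewrite zE kE levelE pth_rootM.
move/ideal_gen1P => [c ->]; split; apply/ideal_gen1P.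
  by exists (c * pth_root charRp e u); rewrite -mulrA pth_rootM -al.
by exists (c * pth_root charRp e v); rewrite -mulrA pth_rootM -bl.
Qed.

End GCD.

(** * Coherence of the perfection *)

Section CoherentPerfection.
Variables (R : idomainType) (p : nat) (charRp : p \in [pchar R]) (M : set R).
Hypotheses (noeth : noetherian R) (locM : local_with M).
Hypotheses (Fpure : F_pure charRp) (coh : coherent (perfection charRp)).

Let p1 : (1 < p)%N. Proof. exact/prime_gt1/(pcharf_prime charRp). Qed.

Lemma ideal_gen_exp (s : seq R) r e : ideal_gen [set` s] r ->
  ideal_gen [set` [seq x ^+ (p ^ e) | x <- s]] (r ^+ (p ^ e)).
Proof.
move=> /ideal_gen_sumP [c ->]; rewrite (expr_pchar_pow_sum charRp).
apply/ideal_gen_sumP; exists (fun i => c i ^+ (p ^ e)); rewrite size_map.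
by apply: eq_bigr => i _; rewrite exprMn (nth_map 0).
Qed.

(** The multiplier [c] of an element of the tight closure outside [I] would
    lie in all powers of the maximal ideal. *)
Lemma coherent_weakly_F_regular : weakly_F_regular R p.
Proof.
move=> I iI; apply/seteqP; split=> [r Ir|r [c [cmin [e0 ce]]]].
  exists 1; split=> [P [[iP nP _] _] //|].
  by exists 0%N => e _; rewrite mul1r; apply: ideal_gen_sub; exists r.
have c0 : c != 0.
  apply/eqP => c0; apply: (cmin [set 0]) c0; split.
    split; [exact: ideal_zero|by move=> /= /eqP; rewrite oner_eq0|].
    by move=> x y /= /eqP; rewrite mulf_eq0 => /orP [/eqP|/eqP]; [left|right].
  move=> Q [iQ _ _] Q0; apply/seteqP; split=> // x /= ->; exact: ideal0.
apply: contrapT => nr; have [s Is] := noeth iI; rewrite Is in nr.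
have [e1 he] := coherent_colon_powers Fpure noeth locM coh nr.
apply: (krull_intersection noeth locM (x := c)).
  by move=> z /= /eqP; rewrite mulf_eq0 (negbTE c0) orbF => /eqP.
(* [n + e0] in place of [n] makes the exponent large enough for [ce]. *)
move=> n; apply: (@ideal_powW _ M _ (p ^ (n + e0))).
  by apply: ltnW; apply: leq_ltn_trans (ltn_expl _ p1); apply: leq_addr.
apply: he; rewrite /colon /=.
have /ce : (e0 <= n + e0 + e1)%N by rewrite -addnA addnCA leq_addr.
apply: ideal_gen_min; first exact: ideal_gen_ideal.
by move=> _ [x Ix <-]; apply: ideal_gen_exp; rewrite -Is.
Qed.

(** The depth [k] bounds the order of growth of the lengths of [R / M^n], hence
    the dimension. *)
Lemma coherent_cohen_macaulay : cohen_macaulay_local R.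
Proof.
have i0 := ideal_zero R.
have [s [sM rs smax]] := regseq_maximal noeth locM.
have is0 := addl_ideal s i0.
have [r nr soc] := depth0_socle noeth locM is0 smax.
have [N hN] := saturation_finite noeth is0 (local_unit_mod noeth locM).
have [e1 he] : exists e1, forall e,
  colon (ideal_gen [set` [seq x ^+ (p ^ (e + e1)) | x <- s]]) (r ^+ (p ^ (e + e1)))
    `<=` ideal_pow M (p ^ e).
  by apply: (coherent_colon_powers Fpure noeth locM coh); rewrite ideal_gen_addl.
have growth e : len_le (ideal_pow M (p ^ e)) setT (N * (p ^ (e + e1)) ^ size s).
  (* A chain above [M ^ (p ^ e)] is transported, by multiplication by the power
     of [r], to a chain in the torsion modulo the powers of [s]. *)
  move=> n hn; apply: (len_le_saturation_regseq (M := M) i0 rs hN).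
  rewrite -ideal_gen_addl; set J := ideal_gen _.
  have iJ : is_ideal J := ideal_gen_ideal _.
  have iS := saturation_ideal M iJ.
  apply: len_geS (len_ge_colon iJ (ideal_pow_ideal _ _) (he e) hn) => //.
  move=> z [v _ Jz]; rewrite -(subrK (v * r ^+ (p ^ (e + e1))) z).
  apply: (idealD iS); first exact: saturation_sub.
  apply: (ideal_mull _ iS) => w Mw; exists (p ^ (e + e1))%N.
  by rewrite -exprMn; apply: ideal_gen_exp; rewrite ideal_gen_addl; apply: soc.
have dim n (c : nat -> set R) : prime_chain n c -> (n <= size s)%N.
  by move=> pc; apply: (prime_chain_le_growth noeth locM p1 growth pc).
have regseq_le t : {in t, forall x, M x} -> regseq [set 0] t ->
    exists c : nat -> set R, prime_chain (size t) c.
  move=> tM rt; have [|c [pc _]] := regseq_prime_chain noeth locM i0 tM _ rt.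
    by move=> x /= ->; apply: ideal0 (local_ideal locM).
  by exists c.
exists M => //; exists (size s); split=> //; first exact: regseq_le.
  by exists s; split=> //; apply/(regular_seqP locM sM).
by move=> t /[swap] tM /(regular_seqP locM tM) /(regseq_le t tM) [c /dim].
Qed.

End CoherentPerfection.

Theorem corollary2p4 (R : idomainType) (p : nat) (charRp : p \in [pchar R]%R)
    (R_local : local_ring R) (R_noeth : noetherian R) (R_Fpure : F_pure charRp)
    (R_ufd : ufd R) :
  gcd_domain (perfection charRp) /\
  (~ weakly_F_regular R p \/ (excellent R /\ ~ cohen_macaulay_local R) ->
   ~ coherent (perfection charRp)).
Proof.
split; first exact: perfection_gcd.
have [M locM] := R_local.
move=> h coh; case: h => [|[_]]; apply.
  exact: coherent_weakly_F_regular locM R_Fpure coh.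
exact: coherent_cohen_macaulay locM R_Fpure coh.
Qed.
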